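(* Let $0<\varepsilon<1/10$ be a number, and let $d$ be a real number such that $10\varepsilon^{1/5}\le d<1/3$. Let $G=(V,E)$ be a bipartite graph with bipartition $V=A\cup B$, $|A|=|B|=n$, and bipartite density $d_G$, and assume that $r(1-\lambda)\le \deg(v)\le r$ for every $v\in V$, where $r\ge d^{1/3}n$ and $0\le\lambda\le d^4/2$. If $n>\exp(150\log(1/d)/\varepsilon^2)$, then there exists a natural number $K\le 8\frac{d_G}{d}\cdot d^{-100/\varepsilon^2}$ such that $G$ admits the following decomposition: (i) $A=A_1\cup\dots\cup A_K\cup A_0$ and $B=B_1\cup\dots\cup B_K\cup B_0$, where $A_i\cap A_j=B_i\cap B_j=\emptyset$ whenever $i\ne j$; (ii) $|A_0\cup B_0|<8\sqrt[3]{d}\,n$; (iii) $|A_i|,|B_i|\ge d^{101/\varepsilon^2}\cdot\frac{n}{4}=\Omega\left(n^{1/3}(\log n)^{-1/2}\right)$ for every $1\le i\le K$; (iv) $\big||A_i|-|B_i|\big|\le 2\varepsilon^2|A_i|$ for every $1\le i\le K$; (v) the bipartite subgraphs $G[A_i,B_i]\subset G$ for $1\le i\le K$ are all $(\varepsilon',d_i)$-bundles, where $\varepsilon'\le(64\varepsilon)^{1/5}$ and $d_i\ge d-2\varepsilon$.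
   Context: All graphs are simple and finite. For disjoint vertex sets $X,Y$ of a graph $G$, $G[X,Y]$ is the bipartite subgraph of $G$ with parts $X$ and $Y$ containing all edges of $G$ with one endpoint in $X$ and the other in $Y$. The bipartite density of a bipartite graph $H=(A,B)$ is $d_H=d_H(A,B)=\frac{e(H[A,B])}{|A|\cdot|B|}$, and $d_H(X,Y)=\frac{e(H[X,Y])}{|X|\cdot|Y|}$ for nonempty $X\subseteq A$, $Y\subseteq B$. The notation $z=x\pm y$ means $x-y\le z\le x+y$. A bipartite graph $H=(A,B)$ is an $\varepsilon$-regular pair if for every $X\subseteq A$, $Y\subseteq B$ with $|X|\ge\varepsilon|A|$ and $|Y|\ge\varepsilon|B|$ we have $|d_H(A,B)-d_H(X,Y)|\le\varepsilon$. $H=(A,B)$ is an $(\varepsilon,\delta)$-bundle if it is an $\varepsilon$-regular pair, $\deg(v)=\delta|B|\pm\varepsilon|B|$ for every $v\in A$, and $\deg(u)=\delta|A|\pm\varepsilon|A|$ for every $u\in B$. *)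

(* Defs.v *)
From mathcomp Require Import all_boot all_order all_algebra.
From mathcomp Require Import all_classical all_reals all_analysis.

Set Implicit Arguments.
Unset Strict Implicit.
Unset Printing Implicit Defensive.

Import Order.TTheory GRing.Theory Num.Theory.
Import numFieldNormedType.Exports.

Local Open Scope ring_scope.

Section Graphs.
Variable V : finType.
Implicit Types (e : rel V) (A B X Y : {set V}).

Definition simple_graph e := symmetric e /\ irreflexive e.

Definition bipartition e A B :=
  [/\ A :|: B = [set: V], [disjoint A & B] &
      forall u v, e u v ->
        ((u \in A) && (v \in B)) || ((u \in B) && (v \in A))].

Definition deg e (v : V) : nat := #|[set u | e v u]|.

(* Edges as ordered pairs in X x Y: each edge is counted once when X and Y are
   disjoint. *)
Definition nedges e X Y : nat :=
  #|[set p : V * V | [&& p.1 \in X, p.2 \in Y & e p.1 p.2]]|.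

(* G[X, Y], kept on the ambient vertex type V; its vertices are those of
   X :|: Y, and all other vertices are isolated. *)
Definition bipartite_sub e X Y : rel V :=
  [rel u v | e u v &&
    (((u \in X) && (v \in Y)) || ((u \in Y) && (v \in X)))].

Variable R : realType.

Definition density e X Y : R :=
  (nedges e X Y)%:R / (#|X|%:R * #|Y|%:R).

(* X and Y range over nonempty sets because densities are only defined there;
   for eps > 0 and nonempty A and B this is no restriction. *)
Definition regular_pair e A B (eps : R) :=
  forall X Y, X \subset A -> Y \subset B -> X != finset.set0 -> Y != finset.set0 ->
    eps * #|A|%:R <= #|X|%:R -> eps * #|B|%:R <= #|Y|%:R ->
    `|density e A B - density e X Y| <= eps.

Definition bundle e A B (eps delta : R) :=
  [/\ regular_pair e A B eps,
      forall v, v \in A ->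
        delta * #|B|%:R - eps * #|B|%:R <= (deg e v)%:R
          <= delta * #|B|%:R + eps * #|B|%:R &
      forall u, u \in B ->
        delta * #|A|%:R - eps * #|A|%:R <= (deg e u)%:R
          <= delta * #|A|%:R + eps * #|A|%:R].

End Graphs.

(* A function of n, so that its growth rate for fixed eps and d can be stated. *)
Definition part_bound (R : realType) (eps d : R) (n : nat) : R :=
  d `^ (101 / eps ^+ 2) * (n%:R / 4).

(* Main.v *)
(* Recursively split A x B into rectangles, cutting a rectangle into four
   whenever a pair of subsets witnesses a large cut deviation.  Each cut raises
   the energy (sum of e^2/area) by kappa^2 times the area, so at depth t the area
   of irregular rectangles is at most |A||B|/(t kappa^2), and 4^t stays far below
   d^(-1/eps^2).  The regular rectangles that are dense and not too small carry
   all but O(d n^2) edges of G.  Since they are disjoint as subsets of A x B, a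
   vertex v may join the rectangle X_i x Y_i with probability about
   deg_{Y_i}(v)/r, the total being at most deg(v)/r <= 1; this makes the pieces
   disjoint, nearly balanced, and leaves few vertices uncovered.  Exponential
   moments give one choice for which all degrees and codegrees into the sampled
   pieces are as expected, and by Cauchy-Schwarz the codegrees force the pairs of
   pieces to be eps'-regular, although their size is only a tiny fraction of the
   rectangles. *)
Require Import Defs.
From mathcomp Require Import all_boot all_order all_algebra.
From mathcomp Require Import all_classical all_reals all_analysis.
From mathcomp Require Import ring lra.

Set Implicit Arguments.
Unset Strict Implicit.
Unset Printing Implicit Defensive.

Import Order.TTheory GRing.Theory Num.Theory.
Import numFieldNormedType.Exports.

Local Open Scope ring_scope.

(** * Tilings by cut-regular rectangles *)

(** The hypothesis on [n] is a lower bound by a power of [1/d] with exponent of order [1/eps^2], so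
    a partition with a tower-type number of classes is unaffordable. Cut regularity costs only [4^t]
    rectangles, but its error is relative to the whole rectangle and may exceed the area of the
    pieces finally kept. Codegrees survive sampling because they are averages over vertices, and
    they control all subsets of a piece at once, with no union bound over subsets. Put
    [h = eps^(1/5)] and [mu = d^(1/eps^2)]. The constants come from reading the argument backwards.
    Final regularity [2 * h] needs centred codegrees of relative size [O(h^4)], hence
    [kappa = h^4 / 2]; the degree tolerance [theta = h^2] then satisfies [theta^2 = 2 * kappa]. The
    energy argument with this [kappa] needs depth about [32 / (d * h^8)], and [10 * h <= d] keeps
    this well below [h^-10 = 1/eps^2]: this is where the fifth root comes from. Finally [mu] serves
    both as the least relative area of a rectangle, so that there are at most [1/mu] of them, and as
    the relative sampling error. *)

Section Rectangles.
Variables (R : realType) (V : finType).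
Implicit Types (X Y S T : {set V}) (P : {set V} * {set V})
  (L : seq ({set V} * {set V})) (f : V -> V -> R).

Definition rsum f P : R := \sum_(x in P.1) \sum_(y in P.2) f x y.

Definition area P : R := rsum (fun _ _ => 1) P.

(** Multiplicities are counted pointwise, so empty rectangles may occur in [L] and additivity of
    every weight is a mere exchange of sums. *)
Definition tiles L P := forall x y,
  (\sum_(Q <- L) ((x \in Q.1) && (y \in Q.2) : nat))%N =
  ((x \in P.1) && (y \in P.2) : nat).

Lemma areaE P : area P = #|P.1|%:R * #|P.2|%:R.
Proof.
by rewrite /area /rsum !sumr_const -mulrnA mulnC natrM.
Qed.

Lemma rsum_indic f P :
  rsum f P = \sum_x \sum_y f x y * ((x \in P.1) && (y \in P.2))%:R.
Proof.
rewrite /rsum big_mkcond; apply: eq_bigr => x _.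
case: ifP => xP; last by rewrite big1 // => y _; rewrite mulr0.
rewrite big_mkcond; apply: eq_bigr => y _.
by case: ifP => yP /=; rewrite ?mulr1 ?mulr0.
Qed.

Lemma rsum_ge0 f P : (forall x y, 0 <= f x y) -> 0 <= rsum f P.
Proof. by move=> f0; apply: sumr_ge0 => x _; apply: sumr_ge0. Qed.

Lemma sum_rsum f L :
  \sum_(P <- L) rsum f P =
  \sum_x \sum_y f x y * (\sum_(Q <- L) ((x \in Q.1) && (y \in Q.2) : nat))%:R.
Proof.
under eq_bigr do rewrite rsum_indic.
rewrite exchange_big; apply: eq_bigr => x _.
rewrite exchange_big; apply: eq_bigr => y _.
by rewrite natr_sum mulr_sumr.
Qed.

Lemma rsum_tiles f L P : tiles L P -> \sum_(Q <- L) rsum f Q = rsum f P.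
Proof.
move=> LP; rewrite sum_rsum rsum_indic.
by apply: eq_bigr => x _; apply: eq_bigr => y _; rewrite LP.
Qed.

(** Kept general in [f]: constant weight bounds areas, and the edges at a single vertex will bound
    the total probability of that vertex. *)
Lemma rsum_filter_le f L P (p : pred _) : (forall x y, 0 <= f x y) ->
  tiles L P -> \sum_(Q <- [seq Q <- L | p Q]) rsum f Q <= rsum f P.
Proof.
move=> f0 /(rsum_tiles f) <-.
rewrite big_filter big_mkcond; apply: ler_sum => Q _.
by case: ifP => // _; exact: rsum_ge0.
Qed.

End Rectangles.

(** * Cut regularity and the energy increment *)

Section CutRegular.
Variables (R : realType) (V : finType) (e : rel V).
Implicit Types (X Y S T : {set V}) (P : {set V} * {set V})
  (L : seq ({set V} * {set V})).

Definition edge x y : R := (e x y)%:R.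

Lemma edge_ge0 x y : 0 <= edge x y.
Proof. exact: ler0n. Qed.

Lemma edge_le1 x y : edge x y <= 1.
Proof. by rewrite /edge lern1 leq_b1. Qed.

Lemma nedgesE X Y : (nedges e X Y)%:R = rsum edge (X, Y).
Proof.
rewrite /nedges -sum1_card natr_sum /rsum pair_big_dep /=.
rewrite big_mkcond [RHS]big_mkcond; apply: eq_bigr => -[x y] _.
rewrite inE /= /edge; case: (x \in X) => //=; case: (y \in Y) => //=.
by case: (e x y).
Qed.

Lemma rsum_edge_le P : rsum edge P <= area R P.
Proof.
by apply: ler_sum => x _; apply: ler_sum => y _; exact: edge_le1.
Qed.

Lemma densityE X Y : density R e X Y = rsum edge (X, Y) / area R (X, Y).
Proof. by rewrite /density nedgesE areaE. Qed.

Definition dens P : R := rsum edge P / area R P.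

Definition dev P S T : R := rsum edge (S, T) - dens P * area R (S, T).

(** Boolean, so that it can filter a sequence. The error is relative to the area of [P] and not of
    [(S, T)], as in the cut norm. *)
Definition cut_regular (kappa : R) P :=
  [forall S : {set V}, forall T : {set V},
    (S \subset P.1) ==> (T \subset P.2) ==>
      (`|dev P S T| <= kappa * area R P)].

Lemma cut_regularP kappa P : reflect
  (forall S T, S \subset P.1 -> T \subset P.2 ->
     `|dev P S T| <= kappa * area R P) (cut_regular kappa P).
Proof.
apply: (iffP idP) => [/forallP H S T SP TP | H].
  by have /forallP/(_ T) := H S; rewrite SP TP.
by apply/forallP => S; apply/forallP => T; apply/implyP => SP; apply/implyP/H.
Qed.

Definition energy P : R := rsum edge P ^+ 2 / area R P.

(** Tangent bound for the convex function [x^2 / a] at slope [x / a = t]. The second premise handles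
    the convention that division by [0] gives [0]. *)
Lemma sqr_div_ge (x a t : R) : 0 <= a -> (a = 0 -> x = 0) ->
  2 * t * x - t ^+ 2 * a <= x ^+ 2 / a.
Proof.
move=> a0 xa; have [/[dup] /xa -> ->|a_neq0] := eqVneq a 0.
  by rewrite !mulr0 subr0 expr0n mul0r.
have a_gt0 : 0 < a by rewrite lt_neqAle eq_sym a_neq0.
rewrite ler_pdivlMr //; have := sqr_ge0 (x - t * a); nra.
Qed.

Lemma area_ge0 P : 0 <= area R P.
Proof. by apply: rsum_ge0 => _ _; exact: ler01. Qed.

Lemma rsum_edge_area0 P : area R P = 0 -> rsum edge P = 0.
Proof.
move=> P0; apply/eqP; rewrite eq_le (rsum_ge0 _ edge_ge0) andbT.
by rewrite -P0 rsum_edge_le.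
Qed.

Lemma rsum_edge_dens P : rsum edge P = dens P * area R P.
Proof.
have [a0|a0] := eqVneq (area R P) 0.
  by rewrite a0 mulr0 rsum_edge_area0.
by rewrite /dens divfK.
Qed.

Lemma energy_le P : energy P <= area R P.
Proof.
rewrite /energy expr2 -mulrA -/(dens P) -[leRHS]mulr1.
have d1 : dens P <= 1.
  rewrite /dens; have [->|a0] := eqVneq (area R P) 0; first by rewrite invr0 mulr0.
  by rewrite ler_pdivrMr ?mul1r ?rsum_edge_le // lt_neqAle eq_sym a0 area_ge0.
apply: ler_pM => //; last exact: rsum_edge_le.
  exact/rsum_ge0/edge_ge0.
by rewrite divr_ge0 ?area_ge0 // rsum_ge0 // => *; exact: edge_ge0.
Qed.

Definition quarter P S T : seq ({set V} * {set V}) :=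
  [:: (S, T); (S, P.2 :\: T); (P.1 :\: S, T); (P.1 :\: S, P.2 :\: T)].

Lemma quarter_tiles P S T : S \subset P.1 -> T \subset P.2 ->
  tiles (quarter P S T) P.
Proof.
move=> /fintype.subsetP SP /fintype.subsetP TP x y.
rewrite !big_cons big_nil /= !inE.
have /implyP := SP x; have /implyP := TP y.
by case: (x \in S); case: (y \in T); case: (x \in P.1); case: (y \in P.2).
Qed.

(** The tangent bounds at [t = dens P] are linear, so over the four quarters they add up to exactly
    [energy P]. On [(S, T)] the tangent bound misses the energy by [dev^2 / area (S, T)], which is
    at least [kappa^2 * area P] because [area (S, T) <= area P]. *)
Lemma energy_quarter kappa P S T : 0 <= kappa ->
  S \subset P.1 -> T \subset P.2 -> kappa * area R P < `|dev P S T| ->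
  energy P + kappa ^+ 2 * area R P <= \sum_(Q <- quarter P S T) energy Q.
Proof.
move=> k0 SP TP dST; set t := dens P.
have aS : 0 < area R (S, T).
  rewrite lt_neqAle area_ge0 andbT eq_sym; apply: contraTneq dST => a0.
  rewrite /dev a0 mulr0 subr0 rsum_edge_area0 // normr0 -leNgt.
  by rewrite mulr_ge0 // area_ge0.
have tl := quarter_tiles SP TP.
have := rsum_tiles edge tl; have := rsum_tiles (fun _ _ => 1 : R) tl.
rewrite !big_cons !big_nil !addr0 -!/(area R _) => aE eE.
have ge (Q : {set V} * {set V}) :
    2 * t * rsum edge Q - t ^+ 2 * area R Q <= energy Q.
  by apply: sqr_div_ge; [exact: area_ge0|exact: rsum_edge_area0].
have PE : energy P = t * rsum edge P.
  by rewrite /energy expr2 -mulrA mulrC.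
have tE : t * area R P = rsum edge P by rewrite -rsum_edge_dens.
have a1 : area R (S, T) <= area R P.
  by rewrite -aE lerDl !addr_ge0 ?area_ge0.
have : 2 * t * rsum edge (S, T) - t ^+ 2 * area R (S, T) + kappa ^+ 2 * area R P
    <= energy (S, T).
  rewrite ler_pdivlMr //.
  have dE : rsum edge (S, T) = t * area R (S, T) + dev P S T.
    by rewrite /dev addrC subrK.
  have d2 : (kappa * area R P) ^+ 2 <= dev P S T ^+ 2.
    rewrite -(real_normK (num_real (dev P S T))) lerXn2r ?nnegrE ?mulr_ge0 ?area_ge0 //.
    exact: ltW.
  have : kappa ^+ 2 * area R P * area R (S, T) <= (kappa * area R P) ^+ 2.
    by rewrite exprMn -mulrA ler_wpM2l ?sqr_ge0 // expr2 ler_wpM2l ?area_ge0.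
  rewrite dE; nra.
have := ge (S, P.2 :\: T); have := ge (P.1 :\: S, T).
have := ge (P.1 :\: S, P.2 :\: T).
rewrite PE -tE; move: eE; rewrite -tE -aE; nra.
Qed.

Lemma tiles_flatten L (F : {set V} * {set V} -> seq ({set V} * {set V})) P :
  tiles L P -> (forall Q, tiles (F Q) Q) -> tiles (flatten (map F L)) P.
Proof.
move=> LP FQ x y; rewrite big_flatten big_map -LP /=.
by apply: eq_bigr => Q _; exact: FQ.
Qed.

(** Cutting stops at regular rectangles, so an irregular rectangle of the final tiling lies below
    [t] successive cuts, and each of these gained energy in proportion to an area that contains
    it. *)
Lemma regular_tiling kappa t P : 0 <= kappa ->
  exists L, [/\ (size L <= 4 ^ t)%N, tiles L P &
    energy P + t%:R * kappa ^+ 2 * (\sum_(Q <- L | ~~ cut_regular kappa Q) area R Q)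
     <= \sum_(Q <- L) energy Q].
Proof.
move=> k0; elim: t P => [|t IH] P.
  exists [:: P]; split=> // [x y|]; first by rewrite big_seq1.
  by rewrite !mul0r big_seq1 addr0.
have [regP|] := boolP (cut_regular kappa P).
  exists [:: P]; split=> // [|x y|]; first by rewrite expn_gt0.
    by rewrite big_seq1.
  by rewrite big_mkcond !big_seq1 regP /= mulr0 addr0.
case/forallPn => S /forallPn[T]; rewrite !negb_imply -ltNge => /and3P[SP TP dST].
have [F FP] := choice IH.
exists (flatten (map F (quarter P S T))); split.
- rewrite size_flatten /shape -map_comp sumnE big_map.
  apply: (@leq_trans (\sum_(Q <- quarter P S T) 4 ^ t)%N).
    by apply: leq_sum => Q _ /=; have [] := FP Q.
  by rewrite !big_cons big_nil !addnA addn0 expnS !mulSn mul0n addn0 !addnA.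
- by apply: tiles_flatten (quarter_tiles SP TP) _ => Q; have [] := FP Q.
have qtl := quarter_tiles SP TP.
have tl : tiles (flatten (map F (quarter P S T))) P.
  by apply: tiles_flatten qtl _ => Q; have [] := FP Q.
set I := \sum_(Q <- _ | _) _.
(* The cut of [P] itself gains [kappa^2 * area P]; only the part [kappa^2 * I] of it is used, which
   is the increment from [t] to [t.+1]. *)
have I0 : 0 <= I by apply: sumr_ge0 => *; exact: area_ge0.
have IP : I <= area R P.
  have := rsum_filter_le (fun Q => ~~ cut_regular kappa Q) (fun _ _ => @ler01 R) tl.
  by rewrite big_filter.
have eq := energy_quarter k0 SP TP dST.
have : \sum_(Q <- quarter P S T) energy Q + t%:R * kappa ^+ 2 * I
    <= \sum_(Q <- flatten (map F (quarter P S T))) energy Q.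
  rewrite /I !big_flatten !big_map mulr_sumr -big_split /=.
  by apply: ler_sum => Q _; have [] := FP Q.
apply: le_trans; apply: le_trans (lerD eq (lexx _)).
have := ler_wpM2l (sqr_ge0 kappa) IP; rewrite -natr1; lra.
Qed.

Lemma irregular_area kappa t P : 0 <= kappa ->
  exists L, [/\ (size L <= 4 ^ t)%N, tiles L P &
    t%:R * kappa ^+ 2 * (\sum_(Q <- L | ~~ cut_regular kappa Q) area R Q)
     <= area R P].
Proof.
move=> /(regular_tiling t P)[L [sL tL eL]]; exists L; split=> //.
rewrite -[area R P](rsum_tiles _ tL).
apply: (@le_trans _ _ (\sum_(Q <- L) energy Q)); last by apply: ler_sum => Q _; exact: energy_le.
apply: le_trans eL; rewrite lerDr /energy divr_ge0 ?sqr_ge0 ?area_ge0 //.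
Qed.

End CutRegular.

(** * Existence of a sample with small deviations *)

Section Sampling.
Variable R : realType.

(** Bounds the factors [1 + s * g] from below, so that a large sum forces a large product. For
    [y >= 0] it follows from [(1 + y) * (1 - y + y^2) = 1 + y^3 >= 1]. *)
Lemma expR_subr_sqr_le (y : R) : `|y| <= 1 / 5 -> expR (y - y ^+ 2) <= 1 + y.
Proof.
rewrite ler_norml => /andP[y1 y2].
have [y0|y0] := leP 0 y.
  have E := expR_ge1Dx (y ^+ 2 - y).
  have P : 0 < 1 + (y ^+ 2 - y) by have := sqr_ge0 (y - 1 / 2); lra.
  rewrite -opprB expRN -[leRHS]invrK lef_pV2 ?posrE ?expR_gt0 ?invr_gt0 //; last lra.
  apply: le_trans E; rewrite -div1r ler_pdivrMr; last lra.
  have : 0 <= y ^+ 3 by rewrite exprn_ge0.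
  nra.
(* For negative [y] the product [1 + y^3] is below [1], so the linear bound on the exponential is
   too weak; it is applied to half the exponent and squared. *)
have E := expR_ge1Dx ((y ^+ 2 - y) / 2).
have P : 0 < 1 + (y ^+ 2 - y) / 2 by nra.
rewrite -opprB expRN -[leRHS]invrK lef_pV2 ?posrE ?expR_gt0 ?invr_gt0 //; last lra.
rewrite (_ : y ^+ 2 - y = 2%:R * ((y ^+ 2 - y) / 2)); last lra.
rewrite expRM_natl; apply: (@le_trans _ _ ((1 + (y ^+ 2 - y) / 2) ^+ 2)); last first.
  by rewrite lerXn2r ?nnegrE ?expR_ge0 // ltW.
rewrite -div1r ler_pdivrMr; last lra.
have c0 : 0 <= 1 + 3 * y - y ^+ 2 + y ^+ 3.
  have : 0 <= (1 / 5 + y) * (y ^+ 2 + 1 - y) by apply: mulr_ge0; nra.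
  nra.
have := mulr_ge0 (sqr_ge0 y) c0; lra.
Qed.

Variables (V C : finType) (p : V -> C -> R).
Hypothesis p_ge0 : forall v c, 0 <= p v c.
Hypothesis p_sum1 : forall v, \sum_c p v c = 1.

(* Under the product measure the factors [1 + tau/2 * g j v] are independent
   with mean 1, so their products have mean 1. *)
Lemma exists_small_sums (J : finType) (g : J -> V -> C -> R) (tau : R) :
  (forall j v c, `|g j v c| <= 1) -> (forall j v, \sum_c p v c * g j v c = 0) ->
  0 < tau <= 2 / 5 -> #|J|%:R < expR (tau ^+ 2 * #|V|%:R / 4) ->
  exists om : {ffun V -> C}, (forall v, 0 < p v (om v)) /\
    forall j, \sum_v g j v (om v) <= tau * #|V|%:R.
Proof.
move=> g1 g0 /andP[tau0 tau1] cardJ.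
(* This maximises [s * tau - s^2], with value [tau^2 / 4]: a sum above [tau * #|V|] would make the
   product at least the exponential in the hypothesis on [#|J|]. *)
pose s := tau / 2.
pose Q (om : {ffun V -> C}) := \prod_v p v (om v).
pose F j (om : {ffun V -> C}) := \prod_v (1 + s * g j v (om v)).
have Q_ge0 om : 0 <= Q om by apply: prodr_ge0.
have Q1 : \sum_om Q om = 1.
  by rewrite -(bigA_distr_bigA p) big1.
have QF j : \sum_om Q om * F j om = 1.
  under eq_bigr do rewrite -big_split /=.
  rewrite -(bigA_distr_bigA (fun v c => p v c * (1 + s * g j v c))) big1 // => v _.
  under eq_bigr do rewrite mulrDr mulr1 mulrCA.
  by rewrite big_split /= p_sum1 -mulr_sumr g0 mulr0 addr0.
(* The [Q]-average of the sum of all [F j] is [#|J|]. Choosing [om] in the support of [Q] is what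
   later keeps every chosen vertex typical for its rectangle. *)
have [om [Qom Fom]] : exists om, 0 < Q om /\ \sum_j F j om <= #|J|%:R.
  apply: contrapT => /forallNP H.
  have H1 om : 0 < Q om -> #|J|%:R < \sum_j F j om.
    by move=> Q0; rewrite ltNge; apply/negP => le; exact: (H om).
  have E : \sum_om Q om * (\sum_j F j om - #|J|%:R) = 0.
    under eq_bigr do rewrite mulrBr.
    rewrite big_split /= sumrN -mulr_suml Q1 mul1r.
    under eq_bigr do rewrite mulr_sumr.
    rewrite exchange_big /=; under eq_bigr do rewrite QF.
    by rewrite sumr_const subrr.
  have T om : 0 <= Q om * (\sum_j F j om - #|J|%:R).
    have := Q_ge0 om; rewrite le_eqVlt => /orP[/eqP <-|Q0]; first by rewrite mul0r.
    by rewrite mulr_ge0 ?(ltW Q0) // subr_ge0 ltW // H1.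
  have : \sum_om Q om = 0.
    rewrite big1 // => om _; apply/eqP; rewrite eq_le Q_ge0 andbT leNgt.
    apply/negP => Q0.
    have := psumr_eq0P (fun om _ => T om) E; move=> /(_ om isT)/eqP.
    by rewrite mulf_eq0 gt_eqF // subr_eq0 gt_eqF // H1.
  by rewrite Q1 => /eqP; rewrite oner_eq0.
exists om; split=> [v|j].
  rewrite lt_neqAle p_ge0 andbT eq_sym; apply: contraTneq Qom => p0.
  by rewrite /Q (bigD1 v) //= p0 mul0r ltxx.
rewrite leNgt; apply/negP => big.
have sg v : `|s * g j v (om v)| <= 1 / 5.
  rewrite normrM ger0_norm ?divr_ge0 ?(ltW tau0) //.
  by have := g1 j v (om v); rewrite /s; have := normr_ge0 (g j v (om v)); nra.
have F_ge : expR (s * (\sum_v g j v (om v)) - s ^+ 2 * #|V|%:R) <= F j om.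
  apply: (@le_trans _ _ (\prod_v expR (s * g j v (om v) - (s * g j v (om v)) ^+ 2))).
    rewrite -expR_sum ler_expR mulr_sumr sumrB lerD2l lerN2.
    rewrite -[#|V|]sum1_card natr_sum mulr_sumr; apply: ler_sum => v _.
    rewrite exprMn ler_wpM2l ?sqr_ge0 // -real_normK ?num_real //.
    by rewrite expr_le1.
  by apply: ler_prod => v _; rewrite expR_ge0 expR_subr_sqr_le.
have FJ : F j om <= #|J|%:R.
  apply: le_trans Fom; rewrite (bigD1 j) //= lerDl; apply: sumr_ge0 => k _.
  apply: prodr_ge0 => v _; have : `|s * g k v (om v)| <= 1 / 5.
    rewrite normrM ger0_norm ?divr_ge0 ?(ltW tau0) //.
    by have := g1 k v (om v); rewrite /s; have := normr_ge0 (g k v (om v)); nra.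
  by rewrite ler_norml; lra.
suff : expR (tau ^+ 2 * #|V|%:R / 4) <= #|J|%:R by rewrite leNgt cardJ.
apply: le_trans FJ; apply: le_trans F_ge; rewrite ler_expR.
have : s * (tau * #|V|%:R) <= s * \sum_v g j v (om v).
  by rewrite ler_pM2l ?ltW // /s divr_gt0.
rewrite /s; lra.
Qed.

Lemma exists_sample (W : finType) (w : C -> W -> V -> R) (tau : R) :
  (forall c k v, `|w c k v| <= 1) -> 0 < tau <= 2 / 5 ->
  (2 * (#|C| * #|W|))%:R < expR (tau ^+ 2 * #|V|%:R / 4) ->
  exists om : {ffun V -> C}, (forall v, 0 < p v (om v)) /\
    forall c k, `|\sum_(v | om v == c) w c k v - \sum_v w c k v * p v c|
      <= tau * #|V|%:R.
Proof.
move=> w1 tau1 cardW.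
(* The sign bit gives two-sided bounds and accounts for the factor [2] in the cardinality
   hypothesis; subtracting [p] centres the indicator of the colour. *)
pose g (j : bool * (C * W)) v c : R :=
  (-1) ^+ j.1 * (w j.2.1 j.2.2 v * ((c == j.2.1)%:R - p v j.2.1)).
have p_le1 v c : p v c <= 1.
  by rewrite -(p_sum1 v) (bigD1 c) //= lerDl sumr_ge0.
have g1 j v c : `|g j v c| <= 1.
  rewrite /g normrM normr_sign mul1r normrM mulr_ile1 //.
  rewrite ler_norml; have := p_ge0 v j.2.1; have := p_le1 v j.2.1.
  by case: (c == _) => /= ? ?; apply/andP; split; lra.
have g0 j v : \sum_c p v c * g j v c = 0.
  pose K := (-1) ^+ j.1 * w j.2.1 j.2.2 v.
  transitivity (K * (\sum_c (p v c * (c == j.2.1)%:R) - (\sum_c p v c) * p v j.2.1)).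
    rewrite mulr_suml -sumrB mulr_sumr; apply: eq_bigr => c _; rewrite /g /K; ring.
  rewrite p_sum1 mul1r (bigD1 j.2.1) //= eqxx mulr1 big1 ?addr0 ?subrr ?mulr0 //.
  by move=> c /negPf ->; rewrite mulr0.
have [|om [om0 omg]] := exists_small_sums g1 g0 tau1.
  by rewrite !card_prod card_bool.
exists om; split=> // c k.
set D := _ - _.
have DE (b : bool) : \sum_v g (b, (c, k)) v (om v) = (-1) ^+ b * D.
  rewrite /D (big_mkcond (fun v => om v == c)) -sumrB mulr_sumr; apply: eq_bigr => v _.
  by rewrite /g; set s := (-1) ^+ _; case: (om v == c) => /=; ring.
have := omg (true, (c, k)); have := omg (false, (c, k)).
by rewrite !DE /= expr0 expr1 ler_norml; lra.
Qed.

End Sampling.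

(** * Typical vertices and samples of a cut-regular pair *)

Section TypicalVertices.
Variables (R : realType) (V : finType) (e : rel V).
Hypothesis e_sym : symmetric e.
Implicit Types (X Y S T : {set V}).

Local Notation adj := (edge R e).
Local Notation dn := (dens R e).

Lemma edge_sym x y : adj x y = adj y x.
Proof. by rewrite /edge e_sym. Qed.

Lemma rsum_edgeC X Y : rsum adj (X, Y) = rsum adj (Y, X).
Proof.
rewrite /rsum exchange_big; apply: eq_bigr => y _.
by apply: eq_bigr => x _; rewrite edge_sym.
Qed.

Lemma areaC X Y : area R (X, Y) = area R (Y, X).
Proof. by rewrite !areaE mulrC. Qed.

Lemma densC X Y : dn (X, Y) = dn (Y, X).
Proof. by rewrite /dens rsum_edgeC areaC. Qed.

Lemma cut_regularC (kappa : R) X Y :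
  cut_regular e kappa (X, Y) -> cut_regular e kappa (Y, X).
Proof.
move=> /cut_regularP H; apply/cut_regularP => S T SY TX.
by rewrite /dev densC areaC rsum_edgeC [area R (Y, X)]areaC; exact: H.
Qed.

Lemma dens_ge0 P : 0 <= dn P.
Proof. by rewrite divr_ge0 ?area_ge0 // rsum_ge0 // => *; exact: edge_ge0. Qed.

Lemma dens_le1 P : dn P <= 1.
Proof.
rewrite /dens; have [->|a0] := eqVneq (area R P) 0.
  by rewrite invr0 mulr0.
by rewrite ler_pdivrMr ?mul1r ?rsum_edge_le // lt_neqAle eq_sym a0 area_ge0.
Qed.

Lemma devE P S T :
  dev R e P S T = \sum_(x in S) \sum_(y in T) (adj x y - dn P).
Proof.
rewrite /dev areaE /rsum /=.
under [RHS]eq_bigr do rewrite sumrB sumr_const.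
rewrite sumrB sumr_const; congr (_ - _).
by rewrite -mulrnA -[RHS]mulr_natr natrM [_%:R * _%:R]mulrC.
Qed.

Definition typical theta X Y : {set V} :=
  [set x in X | `|\sum_(y in Y) adj x y - dn (X, Y) * #|Y|%:R|
                <= theta * #|Y|%:R].

Lemma typical_sub theta X Y : typical theta X Y \subset X.
Proof. by apply/fintype.subsetP => x; rewrite inE => /andP[]. Qed.

(** The vertices of too high degree, taken against all of [Y], have deviation at least [theta] times
    their number times [#|Y|]; cut regularity thus leaves at most [kappa / theta * #|X|] of them,
    and likewise for too low degree. *)
Lemma card_typical (kappa theta : R) X Y : 0 < theta -> 2 * kappa <= theta ^+ 2 ->
  cut_regular e kappa (X, Y) ->
  (1 - theta) * #|X|%:R <= #|typical theta X Y|%:R :> R.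
Proof.
move=> t0 kt /cut_regularP cutXY; set t := dn (X, Y).
have [Y0|Y0] := eqVneq #|Y| 0%N.
  have -> : typical theta X Y = X.
    apply/setP => x; rewrite inE Y0 !mulr0 subr0 big1 ?normr0 ?lexx ?andbT //.
    by move=> y; rewrite (cards0_eq Y0) inE.
  by rewrite ler_piMl // gerBl ltW.
have Yp : 0 < #|Y|%:R :> R by rewrite ltr0n lt0n.
pose Shi := [set x in X | theta * #|Y|%:R < \sum_(y in Y) adj x y - t * #|Y|%:R].
pose Slo := [set x in X | \sum_(y in Y) adj x y - t * #|Y|%:R < - (theta * #|Y|%:R)].
have XU : X \subset typical theta X Y :|: (Shi :|: Slo).
  apply/fintype.subsetP => x xX; rewrite !inE xX /= ler_norml -/t.
  by case: ltP => //= H1; case: ltP => //= H2; rewrite ?orbT // H2 H1.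
have rowE x : \sum_(y in Y) adj x y - t * #|Y|%:R = \sum_(y in Y) (adj x y - t).
  by rewrite sumrB sumr_const mulr_natr.
have hi : theta * #|Shi|%:R <= kappa * #|X|%:R.
  have ShiX : Shi \subset X by apply/fintype.subsetP => x; rewrite inE => /andP[].
  have := cutXY Shi Y ShiX (fintype.subxx _).
  rewrite devE areaE mulrA => /(le_trans (ler_norm _)).
  move=> H; rewrite -(ler_pM2r Yp); apply: le_trans H.
  rewrite mulrAC mulr_natr -sumr_const; apply: ler_sum => x; rewrite inE => /andP[_].
  by rewrite rowE => /ltW.
have lo : theta * #|Slo|%:R <= kappa * #|X|%:R.
  have SloX : Slo \subset X by apply/fintype.subsetP => x; rewrite inE => /andP[].
  have := cutXY Slo Y SloX (fintype.subxx _).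
  rewrite devE areaE mulrA ler_norml => /andP[+ _].
  rewrite lerNl => H; rewrite -(ler_pM2r Yp); apply: le_trans H.
  rewrite mulrAC mulr_natr -sumr_const -sumrN.
  apply: ler_sum => x; rewrite inE => /andP[_].
  by rewrite rowE ltrNr => /ltW.
have cX : #|X|%:R <= #|typical theta X Y|%:R + (#|Shi|%:R + #|Slo|%:R) :> R.
  rewrite -!natrD ler_nat; apply: leq_trans (subset_leq_card XU) _.
  apply: leq_trans (leq_card_setU _ _) _; rewrite leq_add2l.
  exact: leq_card_setU.
have X0 : 0 <= #|X|%:R :> R by [].
have : theta * ((1 - theta) * #|X|%:R) <= theta * #|typical theta X Y|%:R by nra.
by rewrite ler_pM2l.
Qed.

(** Centred codegree: its sum over [x, v] in [S] is a sum over [y] of squared centred degrees into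
    [S]. *)
Definition codev t T x v : R := \sum_(y in T) (adj x y - t) * (adj v y - t).

Lemma sum_norm_le (I : finType) (A : {set I}) (F : I -> R) (b : R) :
  (forall S : {set I}, S \subset A -> `|\sum_(i in S) F i| <= b) ->
  \sum_(i in A) `|F i| <= 2 * b.
Proof.
move=> H; rewrite (bigID (fun i => 0 <= F i)) /= mulr2n mulrDl mul1r.
apply: lerD.
  rewrite (eq_bigr F); last by move=> i /andP[_ ?]; rewrite ger0_norm.
  have SA : [set i in A | 0 <= F i] \subset A.
    by apply/fintype.subsetP => i; rewrite inE => /andP[].
  apply: le_trans (H _ SA); apply: le_trans (ler_norm _).
  by rewrite [leRHS](eq_bigl (fun i => (i \in A) && (0 <= F i))) // => i; rewrite inE.
rewrite (eq_bigr (fun i => - F i)); last first.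
  by move=> i /andP[_]; rewrite -ltNge => /ltW/ler0_norm.
have SA : [set i in A | ~~ (0 <= F i)] \subset A.
  by apply/fintype.subsetP => i; rewrite inE => /andP[].
apply: le_trans (H _ SA); rewrite sumrN -normrN; apply: le_trans (ler_norm _).
rewrite lerN2 [leLHS](eq_bigl (fun i => (i \in A) && ~~ (0 <= F i))) // => i.
by rewrite inE.
Qed.

(** For fixed [x] the factor [adj x y - t] takes only the values [1 - t] on the neighbours of [x]
    and [- t] elsewhere. The signed sum is therefore a combination of two cut deviations whose
    coefficients have absolute values adding up to [1], and this for each single [x]. *)
Lemma sum_codev (kappa : R) X Y S T x : cut_regular e kappa (X, Y) ->
  S \subset X -> T \subset Y ->
  \sum_(v in S) `|codev (dn (X, Y)) T x v| <= 2 * (kappa * area R (X, Y)).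
Proof.
move=> /cut_regularP cutXY SX TY; apply: sum_norm_le => S' S'S.
have S'X := fintype.subset_trans S'S SX.
set t := dn (X, Y).
pose N := [set y in T | e x y]; pose N' := [set y in T | ~~ e x y].
have NY : N \subset Y.
  by apply: fintype.subset_trans TY; apply/fintype.subsetP => y; rewrite inE => /andP[].
have N'Y : N' \subset Y.
  by apply: fintype.subset_trans TY; apply/fintype.subsetP => y; rewrite inE => /andP[].
have -> : \sum_(v in S') codev t T x v =
    (1 - t) * dev R e (X, Y) S' N - t * dev R e (X, Y) S' N'.
  rewrite !devE !mulr_sumr -sumrB; apply: eq_bigr => v _.
  rewrite /codev (bigID (e x)) /= !mulr_sumr -sumrN; congr (_ + _).
    apply: eq_big => [y|y /andP[_ exy]]; first by rewrite inE.
    by rewrite /edge exy.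
  apply: eq_big => [y|y /andP[_ /negPf exy]]; first by rewrite inE.
  by rewrite {1}/edge exy sub0r mulNr.
have t0 := dens_ge0 (X, Y); have t1 := dens_le1 (X, Y).
have := cutXY S' N S'X NY; have := cutXY S' N' S'X N'Y.
rewrite !ler_norml => /andP[? ?] /andP[? ?]; apply/andP; split; rewrite /t; nra.
Qed.

End TypicalVertices.

(** * Transfer of degrees and regularity to sampled pieces *)

Section Samples.
Variables (R : realType) (V : finType) (e : rel V).
Hypothesis e_sym : symmetric e.
Implicit Types (X Y S T A B : {set V}).

Local Notation adj := (edge R e).
Local Notation dn := (dens R e).

Lemma sqr_sum_le (I : finType) (T : {set I}) (F : I -> R) :
  (\sum_(i in T) F i) ^+ 2 <= #|T|%:R * \sum_(i in T) F i ^+ 2.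
Proof.
set s := \sum_(i in T) F i; set s2 := \sum_(i in T) _.
have [T0|T0] := posnP #|T|.
  by rewrite /s big1 ?expr0n ?T0 ?mul0r // => i; rewrite (cards0_eq T0) inE.
have Tp : 0 < #|T|%:R :> R by rewrite ltr0n.
have : 0 <= \sum_(i in T) (#|T|%:R * F i - s) ^+ 2 by apply: sumr_ge0 => i _; exact: sqr_ge0.
rewrite (eq_bigr (fun i => #|T|%:R ^+ 2 * F i ^+ 2 - 2 * #|T|%:R * s * F i + s ^+ 2)).
  rewrite big_split /= sumrB -!mulr_sumr sumr_const -/s -/s2 -mulr_natl => H.
  by rewrite -(ler_pM2l Tp); lra.
by move=> i _; ring.
Qed.

(* The w-weight of the sample T of S is within b of its mean when every element
   of S is kept with probability q / |S|. *)
Definition sampled (q b : R) S T (w : V -> R) :=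
  `|\sum_(v in T) w v - q / #|S|%:R * \sum_(v in S) w v| <= b.

Lemma nedges_bipartite_sub X Y S T : S \subset X -> T \subset Y ->
  nedges (bipartite_sub e X Y) S T = nedges e S T.
Proof.
move=> /fintype.subsetP SX /fintype.subsetP TY.
rewrite /nedges; apply: eq_card => -[x y]; rewrite !inE /bipartite_sub /=.
case: (boolP (x \in S)) => //= /SX ->; case: (boolP (y \in T)) => //= /TY ->.
by rewrite andbT.
Qed.

Lemma deg_bipartite_subl X Y v : [disjoint X & Y] -> v \in X ->
  (deg (bipartite_sub e X Y) v)%:R = \sum_(y in Y) adj v y.
Proof.
move=> XY vX; rewrite /deg -sum1_card natr_sum big_mkcond [RHS]big_mkcond.
apply: eq_bigr => y _; rewrite inE /bipartite_sub /= vX (disjointFr XY vX) /= orbF /edge.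
by case: (e v y); case: (y \in Y).
Qed.

Lemma deg_bipartite_subr X Y v : [disjoint X & Y] -> v \in Y ->
  (deg (bipartite_sub e X Y) v)%:R = \sum_(x in X) adj v x.
Proof.
move=> XY vY; rewrite /deg -sum1_card natr_sum big_mkcond [RHS]big_mkcond.
apply: eq_bigr => x _; rewrite inE /bipartite_sub /= vY (disjointFl XY vY) /= /edge.
by case: (e v x); case: (x \in X).
Qed.

(** Passing from [Y] to [Y'] changes the mean degree of [x] by at most [3 * theta]. One [rho] comes
    from sampling the neighbours of [x], the other from replacing [q] by the actual size of [B]. *)
Lemma typical_degree_sampled (theta q rho : R) X Y B x :
  0 <= theta <= 1 / 4 -> 2 * theta <= dn (X, Y) -> 0 < q -> (0 < #|Y|)%N ->
  (1 - theta) * #|Y|%:R <= #|typical e theta Y X|%:R ->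
  x \in typical e theta X Y ->
  sampled q (rho * q) (typical e theta Y X) B (fun _ => 1) ->
  sampled q (rho * q) (typical e theta Y X) B (adj x) ->
  `|\sum_(y in B) adj x y - dn (X, Y) * #|B|%:R| <= (3 * theta + 2 * rho) * q.
Proof.
move=> /andP[t0 t1] td q0 Y0 cY; rewrite inE => /andP[xX].
set t := dn _ in td *; set Y' := typical e theta Y X in cY *.
have d0 := dens_ge0 R e (X, Y); have d1 := dens_le1 R e (X, Y).
rewrite -/t in d0 d1.
have Yp : 0 < #|Y|%:R :> R by rewrite ltr0n.
have Y'p : 0 < #|Y'|%:R :> R by apply: lt_le_trans cY; apply: mulr_gt0 => //; lra.
have Y'Y : #|Y'|%:R <= #|Y|%:R :> R by rewrite ler_nat subset_leq_card ?typical_sub.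
rewrite /sampled !sumr_const divfK ?gt_eqF //.
set D := \sum_(y in Y') adj x y; set DB := \sum_(y in B) adj x y.
have DY : D <= \sum_(y in Y) adj x y <= D + (#|Y|%:R - #|Y'|%:R).
  rewrite (big_setID Y') /= (finset.setIidPr (typical_sub e theta Y X)) -/D.
  apply/andP; split; first by rewrite lerDl sumr_ge0 // => *; exact: edge_ge0.
  rewrite lerD2l -natrB ?subset_leq_card ?typical_sub //.
  rewrite -cardsDS ?typical_sub // -sum1_card natr_sum.
  by apply: ler_sum => y _; exact: edge_le1.
move: DY; set DD := \sum_(y in Y) adj x y => /andP[DY1 DY2].
rewrite !ler_norml => /andP[T1 T2] /andP[B1 B2] /andP[E1 E2].
have D1 : D / #|Y'|%:R <= t + 3 * theta.
  rewrite ler_pdivrMr //.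
  have : (t + theta) * #|Y|%:R <= (t + 3 * theta) * ((1 - theta) * #|Y|%:R).
    by rewrite mulrA ler_pM2r //; nra.
  have : (t + 3 * theta) * ((1 - theta) * #|Y|%:R) <= (t + 3 * theta) * #|Y'|%:R.
    by apply: ler_wpM2l => //; lra.
  lra.
have D2 : t - 3 * theta <= D / #|Y'|%:R.
  rewrite ler_pdivlMr //.
  have : (t - 2 * theta) * #|Y'|%:R <= (t - 2 * theta) * #|Y|%:R.
    by apply: ler_wpM2l => //; lra.
  have : 0 <= theta * #|Y'|%:R by rewrite mulr_ge0 // ltW.
  lra.
have qD : q / #|Y'|%:R * D = q * (D / #|Y'|%:R) by rewrite mulrAC mulrA.
rewrite qD in E1 E2.
have qD1 := ler_wpM2l (ltW q0) D1; have qD2 := ler_wpM2l (ltW q0) D2.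
have rq : 0 <= rho * q.
  by have := normr_ge0 (#|B|%:R - q); lra.
have tb1 : t * (rho * q) <= rho * q by apply: ler_piMl.
have tb2 : t * (#|B|%:R - q) <= t * (rho * q) by apply: ler_wpM2l.
have tb3 : t * (- (rho * q)) <= t * (#|B|%:R - q) by apply: ler_wpM2l.
by apply/andP; split; lra.
Qed.

Variables (theta kappa q rho h : R) (X Y A B : {set V}).
Hypotheses (h_bnd : 0 < h <= 1 / 30) (kappaE : kappa = h ^+ 4 / 2)
  (thetaE : theta = h ^+ 2) (rho_bnd : 0 <= rho <= h ^+ 4 / 200)
  (q_gt0 : 0 < q).
Let t := dn (X, Y).
Let X' := typical e theta X Y.
Let Y' := typical e theta Y X.
Hypotheses (X_gt0 : (0 < #|X|)%N) (Y_gt0 : (0 < #|Y|)%N)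
  (XY_reg : cut_regular e kappa (X, Y)) (t_ge : 2 * theta <= t)
  (AX' : A \subset X') (BY' : B \subset Y') (AB : [disjoint A & B]).
Hypotheses (A_size : sampled q (rho * q) X' A (fun _ => 1))
  (B_size : sampled q (rho * q) Y' B (fun _ => 1))
  (A_adj : forall u, sampled q (rho * q) X' A (adj u))
  (B_adj : forall u, sampled q (rho * q) Y' B (adj u))
  (A_codev : forall x,
     sampled q (rho * q) X' A (fun v => `|codev e t Y' x v| / #|Y'|%:R))
  (B_codev : forall x v,
     sampled q (rho * q) Y' B (fun y => (adj x y - t) * (adj v y - t))).

Lemma theta_bnd : 0 < theta <= 1 / 900.
Proof. by rewrite thetaE; move: h_bnd => /andP[? ?]; apply/andP; split; nra. Qed.

Lemma cardX' : (1 - theta) * #|X|%:R <= #|X'|%:R.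
Proof.
have /andP[t0 _] := theta_bnd; apply: card_typical t0 _ XY_reg.
by rewrite kappaE thetaE; lra.
Qed.

Lemma cardY' : (1 - theta) * #|Y|%:R <= #|Y'|%:R.
Proof.
have /andP[t0 _] := theta_bnd; apply: card_typical t0 _ (cut_regularC e_sym XY_reg).
by rewrite kappaE thetaE; lra.
Qed.

Lemma X'_gt0 : 0 < #|X'|%:R :> R.
Proof.
apply: lt_le_trans cardX'; apply: mulr_gt0; rewrite ?ltr0n //.
by have /andP[] := theta_bnd; lra.
Qed.

Lemma Y'_gt0 : 0 < #|Y'|%:R :> R.
Proof.
apply: lt_le_trans cardY'; apply: mulr_gt0; rewrite ?ltr0n //.
by have /andP[] := theta_bnd; lra.
Qed.

Lemma size_sample (Z T : {set V}) : 0 < #|Z|%:R :> R -> sampled q (rho * q) Z T (fun _ => 1) ->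
  (1 - rho) * q <= #|T|%:R <= (1 + rho) * q.
Proof.
move=> Z0; rewrite /sampled !sumr_const divfK ?gt_eqF // ler_norml => /andP[? ?].
by apply/andP; split; lra.
Qed.

Lemma rho_le_kappa : rho * (2 + rho) <= kappa / 10.
Proof.
have /andP[r0 r1] := rho_bnd; have /andP[h0 h1] := h_bnd.
have rk : rho <= kappa / 100 by rewrite kappaE; lra.
have : h ^+ 4 <= 1 by apply: exprn_ile1; lra.
have := kappaE => kE h4; have k1 : kappa <= 1 by lra.
nra.
Qed.

(** The test on [B] replaces the inner sum by the codegree in [Y']. With absolute values the
    arbitrary [S] can be enlarged to [A], so the single test [A_codev] serves all [S] and moves the
    outer sum to [X'], where [sum_codev] applies. The sampling errors add up to
    [rho * (2 + rho) * q^2]. *)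
Lemma sum_sampled_codev S x : S \subset A ->
  \sum_(v in S) \sum_(y in B) (adj x y - t) * (adj v y - t) <= 3 * kappa * q ^+ 2.
Proof.
move=> SA.
have X0 := X'_gt0; have Y0 := Y'_gt0; have /andP[t0 t1] := theta_bnd.
have /andP[r0 r1] := rho_bnd.
have /andP[A1 A2] := size_sample X0 A_size.
have qY : 0 <= q / #|Y'|%:R by rewrite divr_ge0 // ltW.
have k0 : 0 <= kappa by rewrite kappaE divr_ge0 // exprn_ge0 // ltW //; case/andP: h_bnd.
apply: (@le_trans _ _ (\sum_(v in A) (q * (`|codev e t Y' x v| / #|Y'|%:R) + rho * q))).
  apply: (@le_trans _ _ (\sum_(v in S) (q * (`|codev e t Y' x v| / #|Y'|%:R) + rho * q))).
    apply: ler_sum => v _.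
    have := B_codev x v; rewrite /sampled ler_norml -/(codev e t Y' x v) => /andP[_].
    have := ler_wpM2l qY (ler_norm (codev e t Y' x v)); lra.
  rewrite [leRHS](big_setID S) /= (finset.setIidPr SA) lerDl sumr_ge0 // => v _.
  by rewrite addr_ge0 ?mulr_ge0 ?invr_ge0 // ltW.
rewrite big_split /= -mulr_sumr sumr_const -[_ *+ #|A|]mulr_natr.
have := A_codev x; rewrite /sampled ler_norml => /andP[_].
rewrite -!mulr_suml; set D := \sum_(v in X') _ => H.
have DXY : D <= 2 * (kappa * (#|X|%:R * #|Y|%:R)).
  by have := sum_codev x XY_reg (typical_sub e theta X Y) (typical_sub e theta Y X); rewrite areaE.
have XY : #|X|%:R * #|Y|%:R <= 101 / 100 * (#|X'|%:R * #|Y'|%:R) :> R.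
  have := cardX'; have := cardY'.
  have a0 : 0 < #|X|%:R :> R by rewrite ltr0n.
  have b0 : 0 < #|Y|%:R :> R by rewrite ltr0n.
  move=> cY cX.
  have /ler_pM := cX; move=> /(_ _ _ _ _ cY) => /(_ ltac:(nra) ltac:(nra)).
  have : 1 <= 101 / 100 * ((1 - theta) * (1 - theta)) by nra.
  have := mulr_gt0 a0 b0; nra.
have D' : D / #|Y'|%:R / #|X'|%:R <= 2 * (kappa * (101 / 100)).
  rewrite -mulrA -invfM mulrC ler_pdivrMl ?mulr_gt0 // mulrC.
  apply: le_trans DXY _.
  have := ler_wpM2l k0 XY; lra.
have D'' : q / #|X'|%:R * (D / #|Y'|%:R) <= q * (2 * (kappa * (101 / 100))).
  by rewrite mulrAC -mulrA ler_pM2l.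
have H1 := ler_wpM2l (ltW q_gt0) (lerD H D'').
have rA : rho * q * #|A|%:R <= rho * q * ((1 + rho) * q).
  by rewrite ler_wpM2l // mulr_ge0 // ltW.
have q2 : 0 <= q ^+ 2 by exact: sqr_ge0.
have := ler_wpM2r q2 rho_le_kappa.
have : 0 <= kappa * q ^+ 2 by rewrite mulr_ge0.
lra.
Qed.

(** Cauchy-Schwarz over [T], then enlarging [T] to [B], gives
    [dev^2 <= 3 * kappa * q^2 * #|S| * #|T|]. Both sets have at least [3/2 * h * q] elements, so the
    squared density error is at most [2/3 * h^2] for [kappa = h^4 / 2]. *)
Lemma sampled_dev S T : S \subset A -> T \subset B ->
  2 * h * #|A|%:R <= #|S|%:R -> 2 * h * #|B|%:R <= #|T|%:R ->
  `|density R e S T - t| <= h.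
Proof.
move=> SA TB hS hT.
have X0 := X'_gt0; have Y0 := Y'_gt0; have /andP[h0 h1] := h_bnd.
have /andP[r0 r1] := rho_bnd.
have /andP[A1 A2] := size_sample X0 A_size.
have /andP[B1 B2] := size_sample Y0 B_size.
have r2 : rho <= 1 / 4.
  have : h ^+ 4 <= 1 by apply: exprn_ile1; lra.
  by lra.
have hr : 0 <= h * q * (1 / 4 - rho) by rewrite mulr_ge0 ?(ltW (mulr_gt0 h0 q_gt0)) //; lra.
have S1 : 3 / 2 * h * q <= #|S|%:R by have := ler_wpM2l (ltW h0) A1; lra.
have T1 : 3 / 2 * h * q <= #|T|%:R by have := ler_wpM2l (ltW h0) B1; lra.
have hq : 0 < 3 / 2 * h * q by rewrite !mulr_gt0.
have S0 := lt_le_trans hq S1; have T0 := lt_le_trans hq T1.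
have devE' : dev R e (X, Y) S T = (density R e S T - t) * (#|S|%:R * #|T|%:R).
  by rewrite /dev densityE areaE mulrBl divfK // mulf_neq0 // gt_eqF.
have sq : dev R e (X, Y) S T ^+ 2 <= #|S|%:R * #|T|%:R * (3 * kappa * q ^+ 2).
  rewrite devE exchange_big /=; apply: le_trans (sqr_sum_le _ _) _.
  rewrite [leRHS](_ : _ = #|T|%:R * (#|S|%:R * (3 * kappa * q ^+ 2))); last by ring.
  rewrite ler_pM2l //.
  apply: (@le_trans _ _ (\sum_(y in B) (\sum_(x in S) (adj x y - t)) ^+ 2)).
    rewrite [leRHS](big_setID T) /= (finset.setIidPr TB) lerDl sumr_ge0 // => y _.
    exact: sqr_ge0.
  apply: (@le_trans _ _ (\sum_(x in S) (3 * kappa * q ^+ 2))).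
    rewrite (eq_bigr (fun y => \sum_(x in S) \sum_(v in S) (adj x y - t) * (adj v y - t))).
      rewrite exchange_big /=; apply: ler_sum => x xS.
      by rewrite exchange_big /=; exact: sum_sampled_codev.
    by move=> y _; rewrite expr2 mulr_suml; apply: eq_bigr => x _; rewrite mulr_sumr.
  by rewrite sumr_const -[leLHS]mulr_natl.
move: sq; rewrite devE'; set D := _ - t => sq.
have ST : 0 < #|S|%:R * #|T|%:R :> R by rewrite mulr_gt0.
have STq : (3 / 2 * h * q) ^+ 2 <= #|S|%:R * #|T|%:R.
  by rewrite expr2 ler_pM // ltW.
have : (D * (#|S|%:R * #|T|%:R)) ^+ 2 <= (h * (#|S|%:R * #|T|%:R)) ^+ 2.
  apply: le_trans sq _; rewrite exprMn expr2 [leRHS]mulrCA.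
  rewrite ler_pM2l //; have := ler_wpM2l (sqr_ge0 h) STq.
  have : 0 <= h ^+ 4 * q ^+ 2 by rewrite mulr_ge0 ?sqr_ge0 // exprn_ge0 // ltW.
  rewrite kappaE; nra.
move=> H; have : D ^+ 2 <= h ^+ 2.
  by rewrite -(ler_pM2r (exprn_gt0 2 ST)) -!exprMn.
by rewrite -[D ^+ 2]real_normK ?num_real // ler_pXn2r ?nnegrE // ltW.
Qed.

Lemma bundle_of_samples : bundle (bipartite_sub e A B) A B (2 * h) t.
Proof.
have /andP[h0 h1] := h_bnd; have /andP[r0 r1] := rho_bnd.
have /andP[t0 t1] := theta_bnd.
have X0 := X'_gt0; have Y0 := Y'_gt0.
have /andP[A1 A2] := size_sample X0 A_size.
have /andP[B1 B2] := size_sample Y0 B_size.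
have r2 : rho <= h / 4.
  apply: le_trans r1 _; have : h ^+ 4 <= h by rewrite -[leRHS]expr1 ler_wiXn2l //; lra.
  lra.
have err : (3 * theta + 2 * rho) * q <= 2 * h * ((1 - rho) * q).
  by rewrite [leRHS]mulrA ler_pM2r // thetaE; nra.
have dAB (Z : {set V}) : (1 - rho) * q <= #|Z|%:R -> 2 * h * ((1 - rho) * q) <= 2 * h * #|Z|%:R.
  by move=> ?; rewrite ler_pM2l //; lra.
have errA := le_trans err (dAB _ A1); have errB := le_trans err (dAB _ B1).
have tw : 0 <= theta <= 1 / 4 by apply/andP; split; lra.
split.
- move=> S T SA TB _ _ hS hT.
  rewrite /density !nedges_bipartite_sub ?fintype.subxx // -!/(density R e _ _).
  (* Densities are compared with [t], the density of the rectangle, and not with that of [(A, B)];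
     the triangle inequality doubles [h]. *)
  have H1 := sampled_dev (fintype.subxx A) (fintype.subxx B).
  have {}H1 : `|density R e A B - t| <= h by apply: H1; rewrite ler_piMl //; lra.
  have H2 := sampled_dev SA TB hS hT.
  by move: H1 H2; rewrite !ler_norml => /andP[? ?] /andP[? ?]; apply/andP; split; lra.
- move=> v vA; rewrite deg_bipartite_subl //.
  have vX : v \in X' by apply: (fintype.subsetP AX').
  have := typical_degree_sampled tw t_ge q_gt0 Y_gt0 cardY' vX B_size (B_adj v).
  rewrite ler_norml -/t => /andP[? ?]; apply/andP; split; lra.
move=> v vB; rewrite deg_bipartite_subr //.
have vY : v \in Y' by apply: (fintype.subsetP BY').
have t_ge' : 2 * theta <= dn (Y, X) by rewrite densC.
have := typical_degree_sampled tw t_ge' q_gt0 X_gt0 cardX' vY A_size (A_adj v).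
rewrite ler_norml densC // -/t => /andP[? ?]; apply/andP; split; lra.
Qed.

End Samples.

(** * Dense regular rectangles and the random assignment *)

Section DenseRectangles.
Variables (R : realType) (V : finType) (e : rel V).
Implicit Types (A B : {set V}) (P Q : {set V} * {set V}).

Local Notation adj := (edge R e).
Local Notation dn := (dens R e).

Lemma tiles_sub (L : seq ({set V} * {set V})) P Q : tiles L P -> Q \in L ->
  Q.1 != finset.set0 -> Q.2 != finset.set0 -> Q.1 \subset P.1 /\ Q.2 \subset P.2.
Proof.
move=> LP QL /set0Pn[x0 x0Q] /set0Pn[y0 y0Q].
have mem x y : x \in Q.1 -> y \in Q.2 -> (x \in P.1) && (y \in P.2).
  move=> xQ yQ; have := LP x y; rewrite (big_rem Q QL) /= xQ yQ.
  by case: ((x \in P.1) && (y \in P.2)).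
by split; apply/fintype.subsetP => z zQ;
  [have /andP[] := mem z y0 zQ y0Q | have /andP[] := mem x0 z x0Q zQ].
Qed.

(** Three kinds of rectangles are discarded: the irregular ones cost area [gamma], the sparse ones
    [d], and the at most [4^t] small ones [4^t * mu <= gamma], each as a fraction of
    [area (A, B)]. *)
Lemma dense_regular_rectangles (kappa d mu gamma : R) (t : nat) A B :
  0 < kappa -> 0 < d -> 0 < mu -> (0 < #|A|)%N -> (0 < #|B|)%N ->
  1 <= gamma * (t%:R * kappa ^+ 2) -> (4 ^ t)%:R * mu <= gamma ->
  exists L : seq ({set V} * {set V}),
    [/\ forall P, P \in L -> [/\ P.1 \subset A, P.2 \subset B,
          cut_regular e kappa P, d <= dn P & mu * area R (A, B) <= area R P],
        forall f : V -> V -> R, (forall x y, 0 <= f x y) ->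
          \sum_(P <- L) rsum f P <= rsum f (A, B) &
        rsum adj (A, B) - (d + 2 * gamma) * area R (A, B)
          <= \sum_(P <- L) rsum adj P].
Proof.
move=> k0 d0 mu0 A0 B0 kt mut.
have [L [sL tL iL]] := irregular_area e t (A, B) (ltW k0).
set a := area R (A, B) in iL *.
have a0 : 0 < a by rewrite /a areaE mulr_gt0 ?ltr0n.
pose good P := [&& cut_regular e kappa P, d <= dn P & mu * a <= area R P].
exists [seq P <- L | good P]; split.
- move=> P; rewrite mem_filter => /andP[/and3P[regP dP aP] PL].
  have P0 : 0 < #|P.1|%:R * #|P.2|%:R :> R.
    by rewrite -areaE; apply: lt_le_trans aP; rewrite mulr_gt0.
  have P1 : P.1 != finset.set0.
    by rewrite -cards_eq0; apply: contraTneq P0 => ->; rewrite mul0r ltxx.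
  have P2 : P.2 != finset.set0.
    by rewrite -cards_eq0; apply: contraTneq P0 => ->; rewrite mulr0 ltxx.
  by have [? ?] := tiles_sub tL PL P1 P2; split.
- by move=> f f0; apply: rsum_filter_le.
set I := \sum_(Q <- L | _) _ in iL.
have Ia : I <= gamma * a.
  have tk : 0 < t%:R * kappa ^+ 2.
    rewrite lt_neqAle mulr_ge0 ?sqr_ge0 // andbT eq_sym.
    by apply: contraTneq kt => ->; rewrite mulr0 -ltNge ltr01.
  rewrite -(ler_pM2l tk); apply: le_trans iL _.
  by rewrite mulrCA mulrA ler_peMl // ltW.
rewrite lerBlDr -(rsum_tiles adj tL) big_filter [leLHS](bigID good) /= lerD2l.
have bnd Q : ~~ good Q -> rsum adj Q <=
    (if ~~ cut_regular e kappa Q then area R Q else 0) + d * area R Q + mu * a.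
  have aQ := area_ge0 R Q.
  have nonneg : 0 <= mu * a by rewrite mulr_ge0 // ltW.
  have dQ : 0 <= d * area R Q by rewrite mulr_ge0 // ltW.
  rewrite /good; case: (cut_regular e kappa Q) => /=; last first.
    by move=> _; have := rsum_edge_le R e Q; lra.
  case: leP => [_|dlt] /=.
    by rewrite -ltNge => /ltW alt; have := rsum_edge_le R e Q; lra.
  by move=> _; rewrite rsum_edge_dens; have := ler_wpM2r aQ (ltW dlt); lra.
apply: (@le_trans _ _ (\sum_(Q <- L | ~~ good Q)
   ((if ~~ cut_regular e kappa Q then area R Q else 0) + d * area R Q + mu * a))).
  exact: ler_sum.
apply: (@le_trans _ _ (\sum_(Q <- L)
   ((if ~~ cut_regular e kappa Q then area R Q else 0) + d * area R Q + mu * a))).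
  rewrite big_mkcond; apply: ler_sum => Q _; case: ifP => // _.
  by rewrite !addr_ge0 ?mulr_ge0 ?area_ge0 ?(ltW d0) ?(ltW mu0) ?(ltW a0) //; case: ifP => // _; exact: area_ge0.
rewrite !big_split /= -big_mkcond /= -/I -mulr_sumr (rsum_tiles _ tL) -/(area R _) -/a.
rewrite big_const_seq count_predT iter_addr_0.
have : mu * a *+ size L <= gamma * a.
  rewrite -mulr_natr mulrAC ler_pM2r //; apply: le_trans mut.
  by rewrite mulrC ler_pM2r // ler_nat.
lra.
Qed.

(** The left side will count the tests: two signs, [K + 1] colours, eight statistics and [(2n)^2]
    pairs of vertices. From [expR x >= (x / 8)^8] and [n * mu^48 > 1] the right side is at least
    [n^7 / 16^8], while the left side is at most [128 * n^3]. *)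
Lemma mul_sqr_lt_expR (n K mu : R) :
  0 < mu <= 1 / 16 -> 1 < n * mu ^+ 150 -> 0 <= K -> K * mu <= 1 ->
  64 * (K + 1) * n ^+ 2 < expR (mu ^+ 6 * n / 2).
Proof.
move=> /andP[mu0 mu1] nmu K0 Kmu.
have le_pow k : (k <= 150)%N -> 1 < n * mu ^+ k.
  move=> k150; have n0 : 0 < n.
    by rewrite -(pmulr_lgt0 _ (exprn_gt0 150 mu0)) (lt_trans ltr01).
  apply: lt_le_trans nmu _; rewrite ler_pM2l // ler_wiXn2l ?(ltW mu0) //; lra.
have n0 : 0 < n by have := le_pow 0%N isT; rewrite expr0 mulr1; lra.
have n1 : 1 <= n by have := le_pow 0%N isT; rewrite expr0 mulr1; lra.
have Kn : K + 1 <= 2 * n.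
  have := le_pow 1%N isT; rewrite expr1 => H.
  have : K < n by rewrite -(ltr_pM2r mu0) (le_lt_trans Kmu).
  lra.
have n40 : 16 ^+ 10 < n.
  have H := le_pow 10%N isT.
  have : mu ^+ 10 <= (1 / 16) ^+ 10 by rewrite lerXn2r ?nnegrE ?(ltW mu0) //; lra.
  rewrite -(ler_pM2l n0) => /(lt_le_trans H).
  rewrite expr_div_n expr1n mulrA mulr1 ltr_pdivlMr ?exprn_gt0 //.
  by rewrite mul1r.
have H48 := le_pow 48%N isT.
set x := mu ^+ 6 * n / 2.
have x0 : 0 <= x by rewrite /x !mulr_ge0 ?exprn_ge0 // ltW.
have Ex : (x / 8) ^+ 8 <= expR x.
  rewrite [X in expR X](_ : x = 8%:R * (x / 8)); last by field.
  rewrite expRM_natl lerXn2r ?nnegrE ?expR_ge0 //; first by lra.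
  by have := expR_ge1Dx (x / 8); lra.
apply: lt_le_trans Ex.
have -> : (x / 8) ^+ 8 = (n * mu ^+ 48) * (n ^+ 7 / 16 ^+ 8).
  by rewrite /x; field.
apply: (@lt_le_trans _ _ (n ^+ 7 / 16 ^+ 8)); last first.
  by rewrite ler_peMl ?divr_ge0 ?exprn_ge0 // ltW.
rewrite ltr_pdivlMr ?exprn_gt0 //.
have n3 : 64 * (K + 1) * n ^+ 2 <= 128 * n ^+ 3.
  have := ler_wpM2r (sqr_ge0 n) Kn; lra.
apply: (@le_lt_trans _ _ (128 * n ^+ 3 * 16 ^+ 8)).
  by rewrite ler_pM2r ?exprn_gt0.
have -> : n ^+ 7 = n ^+ 3 * (n ^+ 3 * n) by ring.
rewrite [128 * _]mulrC -mulrA ltr_pM2l ?exprn_gt0 //.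
apply: (@lt_le_trans _ _ n); first by lra.
by rewrite ler_peMl ?exprn_ege1 // ltW.
Qed.

End DenseRectangles.

(** * Random assignment of the vertices to the rectangles *)

Section Assignment.
Variables (R : realType) (V : finType) (e : rel V) (A B : {set V}) (n : nat).
Variables (r lam d h mu c : R).
Local Notation adj := (edge R e).
Local Notation dn := (dens R e).
Hypothesis e_sym : symmetric e.
Hypothesis AB_bip : bipartition e A B.
Hypotheses (cardA : #|A| = n) (cardB : #|B| = n).
Hypothesis deg_bnd : forall v, r * (1 - lam) <= (deg e v)%:R <= r.
Hypotheses (c_gt0 : 0 < c) (c3 : c ^+ 3 = d) (d_lt : d < 1 / 3)
  (r_ge : c * n%:R <= r) (lam_bnd : 0 <= lam <= d ^+ 4 / 2)
  (h_gt0 : 0 < h) (h_le : 10 * h <= d) (mu_bnd : 0 < mu <= h ^+ 10 / 4)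
  (n_big : 1 < n%:R * mu ^+ 150).
Variable L : seq ({set V} * {set V}).
Hypothesis L_rect : forall P, P \in L -> [/\ P.1 \subset A, P.2 \subset B,
  cut_regular e (h ^+ 4 / 2) P, d <= dn P & mu * area R (A, B) <= area R P].
Hypothesis L_sum : forall f : V -> V -> R, (forall x y, 0 <= f x y) ->
  \sum_(P <- L) rsum f P <= rsum f (A, B).
Hypothesis L_edges : rsum adj (A, B) - 5 / 4 * d * area R (A, B)
  <= \sum_(P <- L) rsum adj P.

Let theta := h ^+ 2.
Let K := size L.
Let P (i : 'I_K) := nth (finset.set0, finset.set0) L i.
Let X i := (P i).1.
Let Y i := (P i).2.
Let X' i := typical e theta (X i) (Y i).
Let Y' i := typical e theta (Y i) (X i).
(* q i is the expected size of both pieces cut out of the rectangle i; the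
   corrections by theta make q i / |X' i| at most deg_{Y i}(v) / r for each
   typical v. *)
Let q i := (dn (P i) - theta) * (1 - theta) * area R (P i) / r.
Let prob (v : V) (i : 'I_K) : R :=
  if v \in X' i then q i / #|X' i|%:R else
  if v \in Y' i then q i / #|Y' i|%:R else 0.
Let p (v : V) (o : option 'I_K) : R :=
  if o is Some i then prob v i else 1 - \sum_i prob v i.

Lemma sum_pieces (F : {set V} * {set V} -> R) :
  \sum_(i < K) F (P i) = \sum_(Q <- L) F Q.
Proof. by rewrite (big_nth (finset.set0, finset.set0)) big_mkord. Qed.

Lemma mem_piece i : P i \in L. Proof. exact: mem_nth. Qed.

Lemma h_le30 : h <= 1 / 30.
Proof. by move: h_le d_lt => ? ?; lra. Qed.

Lemma d_bnd : 0 < d < 1 / 3.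
Proof. by move: h_le h_gt0 d_lt => ? ? ?; apply/andP; split; lra. Qed.

Lemma mu_gt0 : 0 < mu. Proof. by case/andP: mu_bnd. Qed.

Lemma mu_le : mu <= h ^+ 4 / 800.
Proof.
have /andP[_ m1] := mu_bnd; apply: le_trans m1 _.
have -> : h ^+ 10 = h ^+ 4 * h ^+ 6 by rewrite -exprD.
have : h ^+ 6 <= (1 / 30) ^+ 6 by rewrite lerXn2r ?nnegrE ?(ltW h_gt0) ?h_le30 //; lra.
have h4 : 0 < h ^+ 4 by rewrite exprn_gt0.
move=> H; have : h ^+ 4 * h ^+ 6 <= h ^+ 4 * (1 / 30) ^+ 6 by rewrite ler_pM2l.
lra.
Qed.

Lemma h4_le : h ^+ 4 <= h / 1000.
Proof.
have : h ^+ 3 <= (1 / 30) ^+ 3 by rewrite lerXn2r ?nnegrE ?(ltW h_gt0) ?h_le30 //; lra.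
move=> H; have := ler_wpM2l (ltW h_gt0) H; have := h_gt0; lra.
Qed.

Lemma mu_le_d : 8 * mu <= d.
Proof. by have := mu_le; have := h4_le; have := h_gt0; have := h_le; lra. Qed.

Lemma theta_small : 0 < theta <= d / 300.
Proof.
rewrite /theta exprn_gt0 //= expr2.
have h30 : h <= 1 / 30 := h_le30.
have H : h * h <= h * (1 / 30) by rewrite ler_pM2l.
by have := h_le; lra.
Qed.

Lemma n_gt0 : (0 < n)%N.
Proof.
rewrite -(ltr0n R) -(pmulr_lgt0 _ (exprn_gt0 150 mu_gt0)); exact: lt_trans n_big.
Qed.

Lemma nR_gt0 : 0 < n%:R :> R. Proof. by rewrite ltr0n n_gt0. Qed.

Lemma r_gt0 : 0 < r.
Proof. by apply: lt_le_trans r_ge; rewrite mulr_gt0 ?nR_gt0. Qed.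

Lemma lam_small : 0 <= lam <= d / 54.
Proof.
have /andP[l0 l1] := lam_bnd; rewrite l0 /=; apply: le_trans l1 _.
have /andP[d0 d1] := d_bnd.
have : d ^+ 3 <= (1 / 3) ^+ 3 by rewrite lerXn2r ?nnegrE ?(ltW d0) // ltW.
by move=> H; have := ler_wpM2l (ltW d0) H; lra.
Qed.

Lemma degE v : (deg e v)%:R = \sum_u adj v u.
Proof.
rewrite /deg -sum1_card natr_sum big_mkcond; apply: eq_bigr => u _.
by rewrite inE /edge; case: (e v u).
Qed.

Lemma inA_notB v : (v \in B) = (v \notin A).
Proof.
have [ABT dAB _] := AB_bip.
have : v \in A :|: B by rewrite ABT inE.
rewrite inE; have [vA|vA] := boolP (v \in A); first by rewrite (disjointFr dAB vA).
by [].
Qed.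

Lemma deg_sideA v : v \in A -> (deg e v)%:R = \sum_(y in B) adj v y.
Proof.
have [_ _ eAB] := AB_bip.
move=> vA; rewrite degE [RHS]big_mkcond; apply: eq_bigr => u _.
have [//|uB] := boolP (u \in B).
rewrite /edge; case: (boolP (e v u)) => // /eAB.
by rewrite (negPf uB) andbF inA_notB vA.
Qed.

Lemma deg_le_n v : (deg e v)%:R <= n%:R :> R.
Proof.
have [_ _ eAB] := AB_bip; rewrite ler_nat.
have [vA|vA] := boolP (v \in A).
  rewrite -cardB; apply/subset_leq_card/fintype.subsetP => u.
  by rewrite inE => /eAB; rewrite [v \in B]inA_notB vA orbF.
rewrite -cardA; apply/subset_leq_card/fintype.subsetP => u.
by rewrite inE => /eAB; rewrite (negPf vA) /= => /andP[].
Qed.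

Lemma r_le : r <= 2 * n%:R.
Proof.
have : (0 < #|A|)%N by rewrite cardA n_gt0.
rewrite card_gt0 => /set0Pn[v _].
have /andP[H _] := deg_bnd v; have := le_trans H (deg_le_n v).
have /andP[l0 l1] := lam_small; have /andP[d0 d1] := d_bnd.
have l2 : lam <= 1 / 2 by lra.
have : r * lam <= r * (1 / 2) by rewrite ler_pM2l ?r_gt0.
lra.
Qed.

Lemma area_AB : area R (A, B) = n%:R ^+ 2.
Proof. by rewrite areaE /= cardA cardB expr2. Qed.

Lemma edges_AB : r * (1 - lam) * n%:R <= rsum adj (A, B).
Proof.
rewrite /rsum /= -cardA mulr_natr -sumr_const; apply: ler_sum => v vA.
by rewrite -deg_sideA //; case/andP: (deg_bnd v).
Qed.

Lemma c_le : c <= 7 / 10.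
Proof.
rewrite leNgt; apply/negP => c7.
have : (7 / 10) ^+ 3 < c ^+ 3 by rewrite ltrXn2r //; lra.
by rewrite c3; have /andP[] := d_bnd; lra.
Qed.

(** Otherwise all edges would be among the lost [5/4 * d * n^2], but there are at least
    [c * (1 - lam) * n^2] and [d = c^3 <= 49/100 * c]. *)
Lemma pieces_nonempty : (0 < K)%N.
Proof.
rewrite lt0n; apply/eqP => K0.
have := L_edges; rewrite (size0nil K0) big_nil area_AB subr_le0.
have := edges_AB => /le_trans H /H {H}.
have /andP[l0 l1] := lam_small; have /andP[d0 d1] := d_bnd.
have n0 := nR_gt0.
have H : c * n%:R * (1 - lam) * n%:R <= r * (1 - lam) * n%:R.
  by rewrite ler_pM2r // ler_pM2r //; lra.
move=> /(le_trans H); apply/negP; rewrite -ltNge.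
rewrite (_ : c * _ * _ * _ = c * (1 - lam) * n%:R ^+ 2); last by ring.
rewrite ltr_pM2r ?exprn_gt0 //.
have c7 := c_le.
have : d <= 49 / 100 * c.
  rewrite -c3 exprS mulrC ler_pM2r //.
  have : c ^+ 2 <= (7 / 10) ^+ 2 by rewrite lerXn2r ?nnegrE ?(ltW c_gt0) //; lra.
  lra.
have : c * lam <= c * (1 / 100) by rewrite ler_pM2l //; lra.
lra.
Qed.

Lemma piece_sub i : X i \subset A /\ Y i \subset B.
Proof. by have [] := L_rect (mem_piece i). Qed.

Lemma piece_regular i : cut_regular e (h ^+ 4 / 2) (X i, Y i).
Proof. by rewrite /X /Y -surjective_pairing; have [] := L_rect (mem_piece i). Qed.

Lemma piece_dens i : d <= dn (X i, Y i).
Proof. by rewrite /X /Y -surjective_pairing; have [] := L_rect (mem_piece i). Qed.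

Lemma piece_area i : mu * n%:R ^+ 2 <= area R (P i).
Proof. by rewrite -area_AB; have [] := L_rect (mem_piece i). Qed.

Lemma piece_area_gt0 i : 0 < area R (P i).
Proof.
by apply: lt_le_trans (piece_area i); rewrite mulr_gt0 ?exprn_gt0 ?mu_gt0 ?nR_gt0.
Qed.

Lemma piece_card i : (0 < #|X i|)%N /\ (0 < #|Y i|)%N.
Proof.
have := piece_area_gt0 i; rewrite areaE -natrM ltr0n muln_gt0 => /andP[].
by [].
Qed.

Lemma sum_area : \sum_i area R (P i) <= n%:R ^+ 2.
Proof. by rewrite sum_pieces -area_AB; apply: L_sum => *; exact: ler01. Qed.

Lemma number_pieces : K%:R * mu <= 1.
Proof.
have n2 : 0 < n%:R ^+ 2 :> R by rewrite exprn_gt0 ?nR_gt0.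
rewrite -(ler_pM2r n2) mul1r; apply: le_trans sum_area.
rewrite -mulrA mulrC mulr_natr -[X in _ *+ X]card_ord -sumr_const.
by apply: ler_sum => i _; exact: piece_area.
Qed.

Lemma cardX'_ge i : (1 - theta) * #|X i|%:R <= #|X' i|%:R.
Proof.
have /andP[t0 _] := theta_small; apply: card_typical t0 _ (piece_regular i).
by rewrite /theta; lra.
Qed.

Lemma cardY'_ge i : (1 - theta) * #|Y i|%:R <= #|Y' i|%:R.
Proof.
have /andP[t0 _] := theta_small.
apply: card_typical t0 _ (cut_regularC e_sym (piece_regular i)).
by rewrite /theta; lra.
Qed.

Lemma cardX'_gt0 i : 0 < #|X' i|%:R :> R.
Proof.
have [X0 _] := piece_card i.
apply: lt_le_trans (cardX'_ge i); rewrite mulr_gt0 ?ltr0n //.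
by have := theta_small; have := d_bnd; lra.
Qed.

Lemma cardY'_gt0 i : 0 < #|Y' i|%:R :> R.
Proof.
have [_ Y0] := piece_card i.
apply: lt_le_trans (cardY'_ge i); rewrite mulr_gt0 ?ltr0n //.
by have := theta_small; have := d_bnd; lra.
Qed.

Lemma q_ge i : d * mu * n%:R / 4 <= q i.
Proof.
have /andP[t0 t1] := theta_small; have /andP[d0 d1] := d_bnd.
have td : d <= dn (P i) by have [] := L_rect (mem_piece i).
have n0 := nR_gt0; have m0 := mu_gt0; have r0 := r_gt0.
have H : d / 2 <= (dn (P i) - theta) * (1 - theta).
  have : (d - theta) * (1 - theta) <= (dn (P i) - theta) * (1 - theta).
    by rewrite ler_pM2r; lra.
  have : 0 <= theta * theta by rewrite mulr_ge0 // ltW.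
  have : d * theta <= d * (1 / 4) by rewrite ler_pM2l //; lra.
  lra.
rewrite /q ler_pdivlMr //.
apply: (@le_trans _ _ (d * mu * n%:R / 4 * (2 * n%:R))).
  by rewrite ler_pM2l ?r_le // !mulr_gt0.
rewrite (_ : _ * _ = d / 2 * (mu * n%:R ^+ 2)); last by field.
apply: ler_pM; rewrite ?piece_area ?mulr_ge0 ?exprn_ge0 //; lra.
Qed.

Lemma q_gt0 i : 0 < q i.
Proof.
apply: lt_le_trans (q_ge i).
by rewrite !mulr_gt0 ?nR_gt0 ?mu_gt0 //; have /andP[] := d_bnd.
Qed.

Lemma typical_degree_ge (S T : {set V}) (v : V) :
  0 < #|typical e theta S T|%:R :> R -> theta <= dn (S, T) ->
  (1 - theta) * #|S|%:R <= #|typical e theta S T|%:R ->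
  v \in typical e theta S T ->
  (dn (S, T) - theta) * (1 - theta) * area R (S, T) / #|typical e theta S T|%:R
    <= \sum_(y in T) adj v y.
Proof.
move=> S'0 td cS; rewrite inE => /andP[vS]; rewrite ler_norml => /andP[H _].
rewrite ler_pdivrMr // areaE /=.
apply: (@le_trans _ _ ((dn (S, T) - theta) * #|T|%:R * #|typical e theta S T|%:R)).
  rewrite (_ : _ * _ = (dn (S, T) - theta) * #|T|%:R * ((1 - theta) * #|S|%:R)); last by ring.
  by rewrite ler_wpM2l // mulr_ge0 // subr_ge0.
by rewrite ler_pM2r //; lra.
Qed.

(* The edges of e at v, as a weight on A x B. *)
Let star v x y : R := if v \in A then (x == v)%:R * adj v y else (y == v)%:R * adj v x.

Lemma star_ge0 v x y : 0 <= star v x y.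
Proof. by rewrite /star; case: ifP => _; rewrite mulr_ge0 ?edge_ge0. Qed.

Lemma rsum_star v (S T : {set V}) : rsum (star v) (S, T) =
  if v \in A then (v \in S)%:R * \sum_(y in T) adj v y
  else (v \in T)%:R * \sum_(x in S) adj v x.
Proof.
have delta (Z : {set V}) : \sum_(x in Z) (x == v)%:R = (v \in Z)%:R :> R.
  rewrite big_mkcond (bigD1 v) //= eqxx big1 ?addr0 => [|x /negPf ->]; last by case: ifP.
  by case: (v \in Z).
rewrite /rsum /star /=; case: ifP => _.
  by under eq_bigr do rewrite -mulr_sumr; rewrite -mulr_suml delta.
by rewrite exchange_big /=; under eq_bigr do rewrite -mulr_sumr; rewrite -mulr_suml delta.
Qed.

Lemma prob_ge0 v i : 0 <= prob v i.
Proof.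
by rewrite /prob; case: ifP => _; [|case: ifP => _ //]; rewrite divr_ge0 // ltW ?q_gt0.
Qed.

Lemma prob_le v i : r * prob v i <= rsum (star v) (P i).
Proof.
have r0 := r_gt0; have [XA YB] := piece_sub i.
have /andP[t0 t1] := theta_small; have /andP[d0 d1] := d_bnd.
have td := piece_dens i.
have rq : r * q i = (dn (P i) - theta) * (1 - theta) * area R (P i).
  by rewrite /q mulrC divfK // gt_eqF.
have PE : P i = (X i, Y i) by rewrite /X /Y -surjective_pairing.
rewrite /prob; case: ifP => vX.
  have vXi : v \in X i by apply: (fintype.subsetP (typical_sub e theta (X i) (Y i))).
  have vA : v \in A by apply: (fintype.subsetP XA).
  rewrite mulrA rq PE rsum_star vA vXi mul1r; apply: typical_degree_ge => //.
  - exact: cardX'_gt0.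
  - lra.
  - exact: cardX'_ge.
case: ifP => vY; last by rewrite mulr0 rsum_ge0 // => *; exact: star_ge0.
have vYi : v \in Y i by apply: (fintype.subsetP (typical_sub e theta (Y i) (X i))).
have vA : v \in A = false.
  by apply/negbTE; rewrite -inA_notB; apply: (fintype.subsetP YB).
rewrite mulrA rq PE rsum_star vA vYi mul1r densC // areaC.
apply: typical_degree_ge => //.
- exact: cardY'_gt0.
- by rewrite densC //; lra.
- exact: cardY'_ge.
Qed.

(** Sides of different rectangles may overlap, so [v] can belong to many of them. The star of [v] as
    weight in [L_sum] shows that its degrees into their opposite sides still add up to at most
    [deg v <= r]. *)
Lemma sum_prob_le1 v : \sum_i prob v i <= 1.
Proof.
have r0 := r_gt0; rewrite -(ler_pM2l r0) mulr1 mulr_sumr.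
apply: (@le_trans _ _ (\sum_i rsum (star v) (P i))).
  by apply: ler_sum => i _; exact: prob_le.
rewrite sum_pieces; apply: le_trans (L_sum (star_ge0 v)) _.
rewrite rsum_star; have /andP[_ dv] := deg_bnd v.
have le (S : {set V}) : \sum_(y in S) adj v y <= r.
  apply: le_trans dv; rewrite degE big_mkcond; apply: ler_sum => y _.
  by case: ifP => // _; exact: edge_ge0.
case: (v \in A); first by rewrite mul1r.
by case: (v \in B); rewrite ?mul1r ?mul0r ?(ltW r0).
Qed.

Lemma p_ge0 v o : 0 <= p v o.
Proof. by case: o => [i|] /=; rewrite ?prob_ge0 // subr_ge0 sum_prob_le1. Qed.

Lemma p_sum1 v : \sum_o p v o = 1.
Proof.
rewrite (bigD1 None) //= -[RHS](subrK (\sum_i prob v i)); congr (_ + _).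
rewrite (reindex_omap Some id) /=; first by apply: eq_bigl => i; rewrite eqxx.
by case.
Qed.

Lemma sum_prob_A i (w : V -> R) :
  \sum_v (v \in A)%:R * w v * prob v i = q i / #|X' i|%:R * \sum_(v in X' i) w v.
Proof.
have [XA YB] := piece_sub i.
rewrite mulr_sumr [RHS]big_mkcond; apply: eq_bigr => v _; rewrite /prob.
case: ifP => vX.
  have -> : v \in A.
    by apply: (fintype.subsetP XA); apply: (fintype.subsetP (typical_sub e theta _ (Y i))).
  by rewrite mul1r mulrC.
case: ifP => vY; last by rewrite mulr0.
suff -> : v \in A = false by rewrite !mul0r.
apply/negbTE; rewrite -inA_notB; apply: (fintype.subsetP YB).
exact: (fintype.subsetP (typical_sub e theta _ (X i))).
Qed.

Lemma sum_prob_B i (w : V -> R) :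
  \sum_v (v \notin A)%:R * w v * prob v i = q i / #|Y' i|%:R * \sum_(v in Y' i) w v.
Proof.
have [XA YB] := piece_sub i.
rewrite mulr_sumr [RHS]big_mkcond; apply: eq_bigr => v _; rewrite /prob.
have XF : v \in X' i -> v \in A.
  move=> vX.
  by apply: (fintype.subsetP XA); apply: (fintype.subsetP (typical_sub e theta _ (Y i))).
have YF : v \in Y' i -> v \notin A.
  move=> vY; rewrite -inA_notB; apply: (fintype.subsetP YB).
  exact: (fintype.subsetP (typical_sub e theta _ (X i))).
case: (boolP (v \in Y' i)) => vY.
  by rewrite YF // mul1r mulrC; case: ifP => // /XF vA; have := YF vY; rewrite vA.
by case: ifP => [/XF ->|_]; rewrite ?mul0r ?mulr0.
Qed.

(** Since [r * q i] is at least the number of edges of the rectangle minus [2 * theta] times its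
    area, the deficit is the lost edges divided by [r], up to [lam * n]. With [r >= c * n] this is
    of order [d / c * n = c^2 * n], and [c <= 7/10] turns it into a multiple of [c * n]. *)
Lemma sum_q_ge : n%:R - \sum_i q i <= 92 / 100 * c * n%:R.
Proof.
have r0 := r_gt0; have n0 := nR_gt0; have /andP[t0 t1] := theta_small.
have /andP[d0 d1] := d_bnd; have /andP[l0 l1] := lam_small; have c7 := c_le.
have H1 : \sum_i rsum adj (P i) - 2 * theta * n%:R ^+ 2 <= r * \sum_i q i.
  apply: (@le_trans _ _ (\sum_i (rsum adj (P i) - 2 * theta * area R (P i)))).
    rewrite sumrB -mulr_sumr lerD2l lerN2 ler_pM2l ?sum_area //.
    by rewrite mulr_gt0.
  rewrite mulr_sumr; apply: ler_sum => i _.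
  rewrite /q [r * _]mulrC divfK ?gt_eqF // rsum_edge_dens.
  have a0 := piece_area_gt0 i.
  rewrite -mulrBl ler_pM2r //.
  have := dens_le1 R e (P i); have : 0 <= theta * theta by rewrite mulr_ge0 // ltW.
  move=> H H'; have := ler_wpM2l (ltW t0) H'; lra.
have := L_edges; rewrite -sum_pieces area_AB => H2.
have H3 := edges_AB.
have H4 : r * (n%:R - \sum_i q i) <= r * (lam * n%:R) + (5 / 4 * d + 2 * theta) * n%:R ^+ 2.
  lra.
have H5 : (5 / 4 * d + 2 * theta) * n%:R ^+ 2 <= r * (9 / 10 * c * n%:R).
  have dc : d <= 7 / 10 * c * c.
    rewrite -c3 (_ : c ^+ 3 = c * (c * c)); last by ring.
    by rewrite -mulrA ler_pM2r // mulr_gt0.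
  have : (5 / 4 * d + 2 * theta) * n%:R ^+ 2 <= 9 / 10 * (c * n%:R) * (c * n%:R).
    rewrite (_ : _ * (c * _) = 9 / 10 * c * c * n%:R ^+ 2); last by ring.
    by rewrite ler_pM2r ?exprn_gt0 //; lra.
  have cn : 0 <= 9 / 10 * c * n%:R by rewrite ltW // !mulr_gt0.
  have := ler_wpM2r cn r_ge; lra.
have : n%:R - \sum_i q i <= lam * n%:R + 9 / 10 * c * n%:R.
  by rewrite -(ler_pM2l r0); lra.
have : lam * n%:R <= 1 / 100 * c * n%:R.
  rewrite ler_pM2r //.
  have : c * (c * c) <= c * (7 / 10 * (7 / 10)) by rewrite ler_pM2l // ler_pM // ltW.
  have : c ^+ 3 = c * (c * c) by ring.
  by rewrite c3; lra.
have := mulr_gt0 c_gt0 n0; lra.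
Qed.

(* The four statistics controlled in the pieces: sizes, degrees, mean absolute
   centred codegrees, and centred codegrees of two fixed vertices. *)
Let base (i : 'I_K) (a b : bool) (u u' v : V) : R :=
  if a then (if b then 1 else adj u v)
  else if b then `|codev e (dn (X i, Y i)) (Y' i) u v| / #|Y' i|%:R
  else (adj u v - dn (X i, Y i)) * (adj u' v - dn (X i, Y i)).

Lemma edge_dev_le1 (t : R) u v : 0 <= t <= 1 -> `|adj u v - t| <= 1.
Proof.
move=> /andP[t0 t1]; have := edge_ge0 R e u v; have := edge_le1 R e u v.
by rewrite ler_norml => ? ?; apply/andP; split; lra.
Qed.

Lemma base_le1 i a b u u' v : `|base i a b u u' v| <= 1.
Proof.
have t01 : 0 <= dn (X i, Y i) <= 1 by rewrite dens_ge0 dens_le1.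
rewrite /base; case: a; case: b.
- by rewrite normr1.
- by rewrite ger0_norm ?edge_ge0 ?edge_le1.
- rewrite normrM normr_id ger0_norm ?invr_ge0 //.
  rewrite ler_pdivrMr ?cardY'_gt0 // mul1r -sum1_card natr_sum /codev.
  apply: le_trans (ler_norm_sum _ _ _) _; apply: ler_sum => y _.
  by rewrite normrM mulr_ile1 ?edge_dev_le1.
by rewrite normrM mulr_ile1 ?edge_dev_le1.
Qed.

Lemma cardV : #|V| = (2 * n)%N.
Proof.
have [ABT dAB _] := AB_bip.
by rewrite -cardsT -ABT cardsU disjoint_setI0 // cards0 subn0 cardA cardB mul2n addnn.
Qed.

(** The first bit of [k] selects the side, the next two the statistic, and the pair its vertices.
    For the leftover colour [None] only the size is measured. *)
Let wt (o : option 'I_K) (k : bool * (bool * bool) * (V * V)) (v : V) : R :=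
  ((v \in A) == k.1.1)%:R *
  (if o is Some i then base i k.1.2.1 k.1.2.2 k.2.1 k.2.2 v else 1).

Lemma assignment_exists : exists om : {ffun V -> option 'I_K},
  (forall v, 0 < p v (om v)) /\
  forall o k, `|\sum_(v | om v == o) wt o k v - \sum_v wt o k v * p v o|
    <= 2 * mu ^+ 3 * n%:R.
Proof.
have m0 := mu_gt0; have m1 := mu_le_d; have /andP[d0 d1] := d_bnd.
have m3 : mu ^+ 3 <= mu by rewrite -[leRHS]expr1 ler_wiXn2l //; lra.
have mu16 : 0 < mu <= 1 / 16.
  by rewrite m0 /=; have := mu_le; have := h4_le; have := h_le30; lra.
have [|||om [om0 omw]] := exists_sample p_ge0 p_sum1 (w := wt) (tau := mu ^+ 3).
- move=> o k v; rewrite /wt normrM mulr_ile1 //.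
    by case: (_ == _); rewrite ?normr1 ?normr0.
  by case: o => [i|]; rewrite ?base_le1 ?normr1.
- by rewrite exprn_gt0 //=; lra.
- have := mul_sqr_lt_expR mu16 n_big (ler0n R K) number_pieces.
  rewrite cardV !card_prod card_option card_ord card_bool cardV.
  rewrite (_ : (mu ^+ 3) ^+ 2 * _ / 4 = mu ^+ 6 * n%:R / 2); last first.
    by rewrite natrM; field.
  apply: le_lt_trans; rewrite -natr1.
  by rewrite !natrM -addn1 natrD le_eqVlt; apply/orP; left; apply/eqP; ring.
exists om; split=> // o k; apply: le_trans (omw o k) _.
by rewrite cardV natrM mulrCA mulrA.
Qed.

(** Reason for the sampling tolerance [mu^3]: as [q i] is at least [d * mu * n / 4] and
    [8 * mu <= d], the relative error in every piece is at most [mu]. *)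
Lemma error_le i : 2 * mu ^+ 3 * n%:R <= mu * q i.
Proof.
have m0 := mu_gt0; have n0 := nR_gt0; have m1 := mu_le_d.
have H := ler_wpM2l (ltW m0) (q_ge i); apply: le_trans H.
rewrite (_ : 2 * _ * _ = (mu ^+ 2 * n%:R / 4) * (8 * mu)); last by field.
rewrite [leRHS](_ : _ = (mu ^+ 2 * n%:R / 4) * d); last by field.
by rewrite ler_pM2l // !mulr_gt0 ?exprn_gt0.
Qed.

Definition cell (om : {ffun V -> option 'I_K}) (Z : {set V}) (o : option 'I_K) :
  {set V} := [set v in Z | om v == o].

Lemma sum_cell om (o : option 'I_K) (F : V -> R) :
  \sum_(v in cell om A o) F v = \sum_(v | om v == o) (v \in A)%:R * F v /\
  \sum_(v in cell om B o) F v = \sum_(v | om v == o) (v \notin A)%:R * F v.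
Proof.
split; rewrite big_mkcond [RHS]big_mkcond; apply: eq_bigr => v _.
  by rewrite inE; case: (v \in A) => /=; case: ifP => _; rewrite ?mul1r ?mul0r.
by rewrite inE inA_notB; case: (v \in A) => /=; case: ifP => _; rewrite ?mul1r ?mul0r.
Qed.

Lemma bundle_decomposition : exists om : {ffun V -> option 'I_K},
  [/\ #|cell om A None|%:R + #|cell om B None|%:R < 4 * c * n%:R :> R,
      forall i, mu ^+ 2 * n%:R <= #|cell om A (Some i)|%:R /\
                mu ^+ 2 * n%:R <= #|cell om B (Some i)|%:R,
      forall i, `|#|cell om A (Some i)|%:R - #|cell om B (Some i)|%:R|
                  <= 2 * h ^+ 10 * #|cell om A (Some i)|%:R &
      forall i, exists t : R, d <= t /\
        bundle (bipartite_sub e (cell om A (Some i)) (cell om B (Some i)))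
          (cell om A (Some i)) (cell om B (Some i)) (2 * h) t].
Proof.
have [om [om_supp om_test]] := assignment_exists; exists om.
have m0 := mu_gt0; have n0 := nR_gt0; have m1 := mu_le_d.
have /andP[d0 d1] := d_bnd; have hlt := h_le30.
have /andP[_ m10] := mu_bnd.
have SA i a b u u' : sampled (q i) (mu * q i) (X' i) (cell om A (Some i)) (base i a b u u').
  rewrite /sampled; apply: le_trans (error_le i).
  have := om_test (Some i) (true, (a, b), (u, u')).
  rewrite (sum_cell om (Some i) _).1 -sum_prob_A /wt /=.
  by under eq_bigr do rewrite eqb_id; under [X in _ - X]eq_bigr do rewrite eqb_id.
have SB i a b u u' : sampled (q i) (mu * q i) (Y' i) (cell om B (Some i)) (base i a b u u').
  rewrite /sampled; apply: le_trans (error_le i).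
  have := om_test (Some i) (false, (a, b), (u, u')).
  rewrite (sum_cell om (Some i) _).2 -sum_prob_B /wt /=.
  by under eq_bigr do rewrite eqbF_neg; under [X in _ - X]eq_bigr do rewrite eqbF_neg.
(* A dummy vertex for the statistics that ignore one or both of their vertex arguments. *)
have v0 (i : 'I_K) : V by have [] := piece_card i; rewrite card_gt0 => /set0Pn/sigW[].
have sA i := size_sample (cardX'_gt0 i) (SA i true true (v0 i) (v0 i)).
have sB i := size_sample (cardY'_gt0 i) (SB i true true (v0 i) (v0 i)).
have half i : q i / 2 <= (1 - mu) * q i.
  have : q i * mu <= q i * (1 / 2) by rewrite ler_pM2l ?q_gt0 //; lra.
  lra.
split.
- have [u _] : exists u, u \in A by apply/set0Pn; rewrite -card_gt0 cardA n_gt0.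
  have qA i : q i / #|X' i|%:R * \sum_(v in X' i) 1 = q i.
    by rewrite sumr_const divfK ?gt_eqF ?cardX'_gt0.
  have qB i : q i / #|Y' i|%:R * \sum_(v in Y' i) 1 = q i.
    by rewrite sumr_const divfK ?gt_eqF ?cardY'_gt0.
  have pNone (b : bool) (Z : {set V}) : (forall v, (v \in Z) = ((v \in A) == b)) ->
      #|Z| = n -> (forall i, \sum_v ((v \in A) == b)%:R * 1 * prob v i = q i) ->
      #|cell om Z None|%:R <= n%:R - \sum_i q i + 2 * mu ^+ 3 * n%:R.
    move=> ZE cZ qZ.
    have := om_test None (b, (true, true), (u, u)).
    have -> : \sum_v wt None (b, (true, true), (u, u)) v * p v None = n%:R - \sum_i q i.
      rewrite -cZ -sum1_card natr_sum (eq_bigr _ (fun i _ => esym (qZ i))) exchange_big.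
      rewrite [X in _ = X - _]big_mkcond -sumrB; apply: eq_bigr => v _.
      by rewrite -mulr_sumr ZE /wt /=; case: (_ == b); rewrite /= ?mulr1 ?mul1r ?mul0r ?subrr.
    have -> : \sum_(v | om v == None) wt None (b, (true, true), (u, u)) v
        = #|cell om Z None|%:R.
      rewrite -sum1_card natr_sum big_mkcond [RHS]big_mkcond; apply: eq_bigr => v _.
      by rewrite inE ZE /wt /=; case: (_ == b) => /=; case: ifP; rewrite ?mulr1.
    by rewrite ler_norml => /andP[_]; lra.
  have NA := pNone true A (fun v => esym (eqb_id _)) cardA.
  have NB : forall v, (v \in B) = ((v \in A) == false) by move=> v; rewrite eqbF_neg inA_notB.
  have {}NB := pNone false B NB cardB.
  have {}NA : #|cell om A None|%:R <= n%:R - \sum_i q i + 2 * mu ^+ 3 * n%:R.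
    by apply: NA => i; rewrite -[RHS]qA -sum_prob_A; under eq_bigr do rewrite eqb_id.
  have {}NB : #|cell om B None|%:R <= n%:R - \sum_i q i + 2 * mu ^+ 3 * n%:R.
    by apply: NB => i; rewrite -[RHS]qB -sum_prob_B; under eq_bigr do rewrite eqbF_neg.
  have sq := sum_q_ge.
  have m3 : mu ^+ 3 <= mu by rewrite -[leRHS]expr1 ler_wiXn2l //; lra.
  have dc : d <= 49 / 100 * c.
    rewrite -c3 (_ : c ^+ 3 = (c * c) * c); last by ring.
    by rewrite ler_pM2r //; have := ler_pM (ltW c_gt0) (ltW c_gt0) c_le c_le; lra.
  have : mu ^+ 3 * n%:R <= 49 / 800 * c * n%:R by rewrite ler_pM2r //; lra.
  have := mulr_gt0 c_gt0 n0; lra.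
- move=> i; have /andP[A1 _] := sA i; have /andP[B1 _] := sB i.
  have : mu ^+ 2 * n%:R <= q i / 2.
    have := q_ge i.
    have : 8 * mu * (mu * n%:R) <= d * (mu * n%:R) by rewrite ler_pM2r ?mulr_gt0.
    lra.
  by have := half i; split; lra.
- move=> i; have /andP[A1 A2] := sA i; have /andP[B1 B2] := sB i.
  have hi := half i; have q0 := q_gt0 i.
  have : mu * q i <= h ^+ 10 / 4 * q i by rewrite ler_pM2r.
  have h0 : 0 <= h ^+ 10 by rewrite exprn_ge0 // ltW.
  have := ler_wpM2l h0 (le_trans hi A1).
  by rewrite ler_norml => ? ?; apply/andP; split; lra.
move=> i; exists (dn (X i, Y i)); split; first exact: piece_dens.
(* A colour of positive probability is only available to typical vertices, so the pieces lie inside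
   [X' i] and [Y' i]. *)
have supp v : om v = Some i -> (v \in X' i) || (v \in Y' i).
  move=> ov; have := om_supp v; rewrite ov /= /prob.
  by case: ifP => //= _; case: ifP => //= _; rewrite ltxx.
have XF v : v \in X' i -> v \in A.
  move=> vX; apply: (fintype.subsetP (piece_sub i).1).
  exact: (fintype.subsetP (typical_sub e theta _ (Y i))).
have YF v : v \in Y' i -> v \notin A.
  move=> vY; rewrite -inA_notB; apply: (fintype.subsetP (piece_sub i).2).
  exact: (fintype.subsetP (typical_sub e theta _ (X i))).
apply: (@bundle_of_samples _ _ _ e_sym theta (h ^+ 4 / 2) (q i) mu h (X i) (Y i)).
- by rewrite h_gt0.
- by [].
- by [].
- by rewrite (ltW m0) /=; have := mu_le; have := exprn_gt0 4 h_gt0; lra.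
- exact: q_gt0.
- exact: (piece_card i).1.
- exact: (piece_card i).2.
- exact: piece_regular.
- by have := piece_dens i; have /andP[_] := theta_small; lra.
- apply/fintype.subsetP => v; rewrite inE => /andP[vA /eqP/supp/orP[//|/YF]].
  by rewrite vA.
- apply/fintype.subsetP => v; rewrite inE inA_notB => /andP[vB /eqP/supp/orP[/XF|//]].
  by rewrite (negPf vB).
- have [_ dAB _] := AB_bip; rewrite -setI_eq0; apply/eqP/setP => v; rewrite !inE inA_notB.
  by case: (v \in A); rewrite ?andbF.
- exact: (SA i true true (v0 i) (v0 i)).
- exact: (SB i true true (v0 i) (v0 i)).
- by move=> u; exact: (SA i true false u (v0 i)).
- by move=> u; exact: (SB i true false u (v0 i)).
- by move=> x; exact: (SA i false true x (v0 i)).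
by move=> x v; exact: (SB i false false x v).
Qed.

End Assignment.

(** * Constants *)

Section Constants.
Variables (R : realType) (eps d : R).
Hypotheses (eps_gt0 : 0 < eps) (d_bnd : 0 < d < 1 / 3).

Let h := eps `^ (1 / 5).
Let mu := d `^ (1 / eps ^+ 2).

Lemma powR_inv_natX (a : R) (k : nat) : 0 <= a -> (0 < k)%N ->
  (a `^ (1 / k%:R)) ^+ k = a.
Proof.
move=> a0 k0.
by rewrite -powR_mulrn ?powR_ge0 // -powRrM divfK ?powRr1 // pnatr_eq0 -lt0n.
Qed.

Lemma root5_gt0 : 0 < h. Proof. exact: powR_gt0. Qed.

Lemma root5X : h ^+ 5 = eps.
Proof. by rewrite powR_inv_natX // ltW. Qed.

Lemma root5X10 : h ^+ 10 = eps ^+ 2.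
Proof. by rewrite -root5X -exprM. Qed.

Lemma double_root5_le : 2 * h <= (64 * eps) `^ (1 / 5).
Proof.
have h0 := root5_gt0.
have h2 : 0 <= 2 * h by rewrite mulr_ge0 // ltW.
have -> : 2 * h = ((2 * h) ^+ 5) `^ (1 / 5).
  by rewrite -(powR_mulrn 5 h2) -powRrM mul1r mulfV ?powRr1.
apply: ge0_ler_powR; rewrite ?nnegrE ?exprn_ge0 ?mulr_ge0 ?(ltW h0) ?(ltW eps_gt0) //.
by rewrite exprMn root5X; have := eps_gt0; lra.
Qed.

Lemma mu_pos : 0 < mu. Proof. by apply: powR_gt0; case/andP: d_bnd. Qed.

Lemma powR_div_sqr (k : nat) : d `^ (k%:R / eps ^+ 2) = mu ^+ k.
Proof.
by rewrite -(powR_mulrn k (ltW mu_pos)) /mu -powRrM mul1r [in RHS]mulrC.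
Qed.

Lemma expR_ln_inv (k : nat) :
  expR (k%:R * ln (1 / d) / eps ^+ 2) = (mu ^+ k)^-1.
Proof.
have /andP[d0 _] := d_bnd.
rewrite -[mu]lnK ?posrE ?mu_pos // -expRM_natl -expRN /mu ln_powR.
by rewrite div1r lnV ?posrE //; congr expR; ring.
Qed.

(** With [l = 1 / eps^2 >= 36] and [ln d <= d - 1 < - 2/3], the claim reduces to
    [expR (l / 3) ^ 2 >= 4 * l]. The bound [h^10 = eps^2] on the relative error is what balances the
    two sides of a piece. *)
Lemma mu_le_sqr : eps <= 1 / 6 -> mu <= h ^+ 10 / 4.
Proof.
move=> e6; have /andP[d0 d1] := d_bnd; rewrite root5X10.
set l := (eps ^+ 2)^-1.
have e2 : 0 < eps ^+ 2 by rewrite exprn_gt0.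
have l36 : 36 <= l.
  rewrite /l -[36]invrK lef_pV2 ?posrE ?invr_gt0 //.
  rewrite (_ : 36^-1 = (1 / 6) ^+ 2); last by field.
  by rewrite lerXn2r ?nnegrE ?(ltW eps_gt0).
have lnd : ln d <= - (2 / 3).
  have : -1 < d - 1 by lra.
  move=> /le_ln1Dx; rewrite (_ : 1 + (d - 1) = d); [lra | by ring].
have E : mu <= (expR (l / 3) ^+ 2)^-1.
  rewrite /mu /powR gt_eqF // -expRM_natl -expRN ler_expR div1r -/l.
  have := ler_wpM2l (_ : 0 <= l) lnd; lra.
apply: le_trans E _; rewrite -[eps ^+ 2]invrK -/l.
rewrite (_ : l^-1 / 4 = (l * 4)^-1); last by rewrite invfM.
rewrite lef_pV2 ?posrE ?exprn_gt0 ?expR_gt0 ?mulr_gt0 //; last lra.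
apply: (@le_trans _ _ ((1 + l / 3) ^+ 2)); last first.
  by rewrite lerXn2r ?nnegrE ?expR_ge0 ?expR_ge1Dx //; lra.
have : 0 <= (l - 36) * l by rewrite mulr_ge0 //; lra.
lra.
Qed.

Lemma pow4_le (t : nat) : (4 ^ t)%:R * d ^+ (2 * t + 3) <= d / 8.
Proof.
have /andP[d0 d1] := d_bnd.
rewrite natrX exprD exprM mulrA -exprMn.
have d2 : d ^+ 2 <= 1 / 9.
  by have := ler_pM (ltW d0) (ltW d0) (ltW d1) (ltW d1); lra.
have q1 : (4 * d ^+ 2) ^+ t <= 1.
  by apply: exprn_ile1; [rewrite mulr_ge0 ?sqr_ge0|lra].
apply: (@le_trans _ _ (1 * d ^+ 3)).
  by rewrite ler_wpM2r // exprn_ge0 // ltW.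
have := ler_wpM2l (ltW d0) d2; lra.
Qed.

(** The two demands compete: [t] must reach [32 / (d * h^8)], yet [4^t * d^(1/eps^2)] must stay
    small. Since [4 * d^2 <= 1], it is enough that [2 * t + 3 <= 1 / eps^2], the extra [d^3]
    supplying the bound [d / 8]. *)
Lemma exists_depth : 10 * h <= d -> exists t : nat,
  1 <= d / 8 * (t%:R * (h ^+ 4 / 2) ^+ 2) /\ (4 ^ t)%:R * mu <= d / 8.
Proof.
move=> hd; have /andP[d0 d1] := d_bnd; have h0 := root5_gt0.
have h8 : 0 < d * h ^+ 8 by rewrite mulr_gt0 ?exprn_gt0.
pose x := 32 / (d * h ^+ 8); have x0 : 0 <= x by rewrite divr_ge0 // ltW.
have /andP[tx xt] := truncn_itv x0.
exists (Num.truncn x).+1; split.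
  rewrite (_ : _ * _ = (Num.truncn x).+1%:R * (d * h ^+ 8) / 32); last by field.
  rewrite ler_pdivlMr // mul1r.
  by have := ltW xt; rewrite /x ler_pdivrMr.
set t := (Num.truncn x).+1.
have tL : (2 * t + 3)%:R <= 1 / eps ^+ 2.
  have -> : (2 * t + 3)%:R = 2 * (Num.truncn x)%:R + 5 :> R.
    by rewrite natrD natrM /t -natr1; ring.
  apply: (@le_trans _ _ (2 * x + 5)); first by lra.
  rewrite -root5X10 ler_pdivlMr ?exprn_gt0 //.
  have -> : (2 * x + 5) * h ^+ 10 = 64 * h ^+ 2 / d + 5 * h ^+ 10.
    by rewrite /x; field; rewrite !gt_eqF.
  have H1 : 64 * h ^+ 2 / d <= 1 / 2.
    rewrite ler_pdivrMr //; have : h * h <= h * (1 / 30) by rewrite ler_pM2l //; lra.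
    lra.
  have H2 : h ^+ 10 <= (1 / 2) ^+ 10 by rewrite lerXn2r ?nnegrE ?(ltW h0) //; lra.
  lra.
have muL : mu <= d ^+ (2 * t + 3).
  rewrite -(powR_mulrn _ (ltW d0)); apply: ger_powR => //.
  by rewrite d0 /=; lra.
apply: (@le_trans _ _ ((4 ^ t)%:R * d ^+ (2 * t + 3))).
  by rewrite ler_wpM2l.
exact: pow4_le.
Qed.

(** For fixed [eps] and [d] the bound is linear in [m], and for [m >= expR 1] both [m^(1/3) <= m]
    and [(ln m)^(-1/2) <= 1]. *)
Lemma part_bound_Omega : (part_bound eps d : nat -> R) \is 'Omega_(\oo%classic)
  (fun m : nat => m%:R `^ (1 / 3) * (ln m%:R) `^ (- (1 / 2)) : R).
Proof.
have /andP[d0 _] := d_bnd.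
pose C := d `^ (101 / eps ^+ 2) / 4.
have C0 : 0 < C by rewrite divr_gt0 ?powR_gt0.
apply/asboolP; exists C => //.
near=> m.
have m1 : expR 1 <= m%:R :> R by near: m; exact: nbhs_infty_ger.
have m0 : 0 < m%:R :> R by apply: lt_le_trans m1; exact: expR_gt0.
have m2 : 1 <= m%:R :> R by apply: le_trans m1; have := @expR_ge1Dx R 1; lra.
have l1 : 1 <= ln m%:R :> R by rewrite -[leLHS]expRK ler_ln ?posrE ?expR_gt0.
have E : part_bound eps d m = C * m%:R.
  by rewrite /part_bound /C; ring.
rewrite E !ger0_norm ?mulr_ge0 ?powR_ge0 ?(ltW C0) //.
rewrite ler_pM2l // -[leRHS]mulr1; apply: ler_pM; rewrite ?powR_ge0 //.
  by apply: ler1_powR => //; lra.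
rewrite powRN invf_le1 ?powR_gt0 //; last lra.
by rewrite -[leLHS](powRr0 (ln m%:R)) ler_powR //; lra.
Unshelve. all: by end_near.
Qed.

End Constants.

Theorem theorem3p2 (R : realType) (eps d : R)
  (heps : 0 < eps < 1 / 10)
  (hd : 10 * eps `^ (1 / 5) <= d < 1 / 3)
  (V : finType) (e : rel V) (A B : {set V}) (n : nat) (r lam : R)
  (hG : simple_graph e)
  (hAB : bipartition e A B)
  (hA : #|A| = n) (hB : #|B| = n)
  (hdeg : forall v : V, r * (1 - lam) <= (deg e v)%:R <= r)
  (hr : d `^ (1 / 3) * n%:R <= r)
  (hlam : 0 <= lam <= d ^+ 4 / 2)
  (hn : expR (150 * ln (1 / d) / eps ^+ 2) < n%:R) :
  exists K : nat,
    [/\ (0 < K)%N,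
        K%:R <= 8 * (density R e A B / d) * d `^ (- (100 / eps ^+ 2)) &
    exists A_ B_ : 'I_K.+1 -> {set V},
      [/\ (* (i) *)
          [/\ A = \bigcup_(i < K.+1) A_ i,
              B = \bigcup_(i < K.+1) B_ i &
              forall i j : 'I_K.+1, i != j ->
                [disjoint A_ i & A_ j] /\ [disjoint B_ i & B_ j]],
          (* (ii) *)
          #|A_ ord0 :|: B_ ord0|%:R < 8 * d `^ (1 / 3) * n%:R,
          (* (iii) *)
          (forall i : 'I_K.+1, i != ord0 ->
             part_bound eps d n <= #|A_ i|%:R /\
             part_bound eps d n <= #|B_ i|%:R) /\
          (part_bound eps d : nat -> R) \is 'Omega_(\oo%classic)
            (fun m : nat => m%:R `^ (1 / 3) * (ln m%:R) `^ (- (1 / 2)) : R),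
          (* (iv) *)
          forall i : 'I_K.+1, i != ord0 ->
            `| #|A_ i|%:R - #|B_ i|%:R | <= 2 * eps ^+ 2 * #|A_ i|%:R &
          (* (v) *)
          exists eps' : R, eps' <= (64 * eps) `^ (1 / 5) /\
            forall i : 'I_K.+1, i != ord0 ->
              exists d_i : R, d - 2 * eps <= d_i /\
                bundle (bipartite_sub e (A_ i) (B_ i)) (A_ i) (B_ i) eps' d_i]].
Proof.
have /andP[eps0 eps1] := heps; have /andP[hd1 hd2] := hd.
have [e_sym _] := hG.
set h := eps `^ (1 / 5) in hd1.
have h_gt0 : 0 < h by exact: root5_gt0.
have d0 : 0 < d by lra.
have d_bnd : 0 < d < 1 / 3 by rewrite d0.
set mu := d `^ (1 / eps ^+ 2).
have mu0 : 0 < mu by exact: mu_pos.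
have h30 : h <= 1 / 30 by lra.
have h10 : h ^+ 10 = eps ^+ 2 by exact: root5X10.
have mu_le : mu <= h ^+ 10 / 4 by apply: mu_le_sqr => //; lra.
have mu_bnd : 0 < mu <= h ^+ 10 / 4 by rewrite mu0.
set c := d `^ (1 / 3) in hr *.
have c0 : 0 < c by exact: powR_gt0.
have c3 : c ^+ 3 = d by rewrite powR_inv_natX // ltW.
have n_big : 1 < n%:R * mu ^+ 150.
  by move: hn; rewrite (expR_ln_inv _ d_bnd) // -div1r ltr_pdivrMr ?exprn_gt0.
have n0 : (0 < n)%N.
  rewrite -(ltr0n R) -(pmulr_lgt0 _ (exprn_gt0 150 mu0)); exact: lt_trans n_big.
have mu1 : mu <= 1.
  apply: le_trans mu_le _; rewrite h10.
  have : eps ^+ 2 <= 1 by apply: exprn_ile1; lra.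
  lra.
have nR : 0 < n%:R :> R by rewrite ltr0n.
(* This reduces the bound on [K] to [K <= mu^-100], which follows from [K * mu <= 1]. *)
have dens_ge : 1 <= 8 * (density R e A B / d).
  have cd : d <= c by apply: ger1_powR; lra.
  have l1 : 1 / 2 <= 1 - lam.
    have /andP[_ l2] := hlam; have : d ^+ 4 <= 1 by apply: exprn_ile1; lra.
    lra.
  have H : d * n%:R * (1 / 2) <= r * (1 - lam).
    apply: ler_pM; rewrite ?mulr_ge0 ?(ltW d0) ?(ltW nR) //; apply: le_trans hr.
    by rewrite ler_pM2r.
  rewrite mulrA ler_pdivlMr // mul1r densityE areaE /= hA hB.
  rewrite mulrA ler_pdivlMr ?mulr_gt0 //.
  have := edges_AB hAB hA hdeg; have := ler_wpM2r (ltW nR) H.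
  have := mulr_gt0 d0 (mulr_gt0 nR nR); lra.
have pb : part_bound eps d n <= mu ^+ 2 * n%:R.
  rewrite /part_bound (powR_div_sqr eps d_bnd 101) -/mu.
  have m2 : mu ^+ 101 <= mu ^+ 2 by rewrite ler_wiXn2l // ltW.
  have m0 : 0 <= mu ^+ 2 * n%:R by rewrite mulr_ge0 ?exprn_ge0 ?(ltW mu0) ?(ltW nR).
  have := ler_wpM2r (ltW nR) m2; lra.
have [t [t1 t2]] := exists_depth eps0 d_bnd hd1.
have k0 : 0 < h ^+ 4 / 2 by rewrite divr_gt0 ?exprn_gt0.
have A0 : (0 < #|A|)%N by rewrite hA.
have B0 : (0 < #|B|)%N by rewrite hB.
have [L [L_rect L_sum L_edges]] := dense_regular_rectangles e k0 d0 mu0 A0 B0 t1 t2.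
have {}L_edges : rsum (edge R e) (A, B) - 5 / 4 * d * area R (A, B)
    <= \sum_(P <- L) rsum (edge R e) P.
  by apply: le_trans L_edges; rewrite (_ : d + 2 * (d / 8) = 5 / 4 * d) //; field.
have L0 := pieces_nonempty hAB hA hB hdeg c0 c3 hd2 hr hlam h_gt0 hd1 mu_bnd n_big L_edges.
have Lmu := number_pieces hA hB mu_bnd n_big L_rect L_sum.
have [om [om_ii om_iii om_iv om_v]] := bundle_decomposition e_sym hAB hA hB hdeg c0 c3
  hd2 hr hlam h_gt0 hd1 mu_bnd n_big L_rect L_sum L_edges.
exists (size L); split=> //.
  rewrite powRN (powR_div_sqr eps d_bnd 100) -/mu.
  apply: (@le_trans _ _ (1 * (mu ^+ 100)^-1)); last first.
    by rewrite ler_wpM2r ?invr_ge0 ?exprn_ge0 // ltW.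
  rewrite mul1r -div1r ler_pdivlMr ?exprn_gt0 //.
  apply: le_trans Lmu; rewrite ler_wpM2l // -[leRHS]expr1.
  by rewrite ler_wiXn2l // ltW.
(* [unlift ord0] matches the indices with the colours: [ord0] corresponds to [None], so index [0]
   collects the uncovered vertices. *)
have unliftE (o : option 'I_(size L)) : exists i : 'I_(size L).+1, unlift ord0 i = o.
  case: o => [i|]; first by exists (lift ord0 i); rewrite liftK.
  by exists ord0; rewrite unlift_none.
have cover (Z : {set V}) : Z = \bigcup_(i < (size L).+1) cell om Z (unlift ord0 i).
  apply/setP => v; apply/idP/bigcupP => [vZ|[i _]]; last by rewrite inE => /andP[].
  by have [i Ei] := unliftE (om v); exists i => //; rewrite inE vZ Ei eqxx.
have disj (Z : {set V}) (i j : 'I_(size L).+1) : i != j ->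
    [disjoint cell om Z (unlift ord0 i) & cell om Z (unlift ord0 j)].
  move=> ij; rewrite -setI_eq0; apply/eqP/setP => v; rewrite !inE.
  apply/negbTE; apply: contra ij => /andP[/andP[_ /eqP ->] /andP[_ /eqP]].
  by case: unliftP => [i' ->|->]; case: unliftP => [j' ->|->] // [->].
exists (fun i => cell om A (unlift ord0 i)), (fun i => cell om B (unlift ord0 i)).
have pieceE (i : 'I_(size L).+1) : i != ord0 -> exists j, unlift ord0 i = Some j.
  by case: unliftP => [j _ _|-> /eqP//]; exists j.
split.
- by split=> // i j ij; split; exact: disj.
- rewrite unlift_none; apply: (@le_lt_trans _ _ (#|cell om A None|%:R + #|cell om B None|%:R)).
    by rewrite -natrD ler_nat leq_card_setU.
  by apply: lt_le_trans om_ii _; rewrite ler_pM2r // ler_pM2r // ler_nat.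
- split; last exact: part_bound_Omega.
  move=> i /pieceE[j ->]; have [a b] := om_iii j.
  by split; exact: le_trans pb _.
- by move=> i /pieceE[j ->]; rewrite -h10.
exists (2 * h); split; first exact: double_root5_le.
move=> i /pieceE[j ->]; have [s [ds bs]] := om_v j; exists s; split=> //.
by apply: le_trans ds; rewrite gerBl mulr_ge0 // ltW.
Qed.
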